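(* Let $0\le k\le m$, $m\ge1$, $c\in\mathbb{R}$, and let $\varepsilon_j=-1$ for $j\le k$, $\varepsilon_j=1$ for $j\ge k+1$. Let $$M_c=\Big\{\lambda(t_1,\dots,t_m)\in C_k^m:\ t\in\mathbb{R}^m,\ \sum_{j=1}^m\varepsilon_jt_j^2=1,\ \lambda\in\mathbb{C}\setminus\{0\},\ \mathrm{Im}(\lambda^m)=c\Big\}$$ or $$M_c=\Big\{\lambda(t_1,\dots,t_m)\in C_k^m:\ t\in\mathbb{R}^m,\ \sum_{j=1}^m\varepsilon_jt_j^2=-1,\ \lambda\in\mathbb{C}\setminus\{0\},\ \mathrm{Im}(\lambda^m)=c\Big\}.$$ Then $M_c$, with a suitable choice of orientation, is an indefinite special Lagrangian submanifold of $C_k^m$.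
   Context: $C_k^m$ denotes $\mathbb{C}^m=\mathbb{R}^{2m}$ with coordinates $z_j=x_j+iy_j$, metric $g_{(2k,2m)}=\sum_{j}\varepsilon_j(dx_j^2+dy_j^2)$ and symplectic form $\omega_{(k,m)}=\sum_{j}\varepsilon_j\,dx_j\wedge dy_j$. A real $m$-dimensional submanifold $M$ is Lagrangian if $\omega_{(k,m)}|_M\equiv0$ and the metric induced by $g_{(2k,2m)}$ on $M$ is non-degenerate. An oriented Lagrangian submanifold $M$ is indefinite special Lagrangian if $dz_1\wedge\cdots\wedge dz_m(e_1,\dots,e_m)=1$ for every positively oriented Lorentz basis $e_1,\dots,e_m$ of every $T_pM$ (Lorentz basis: $g_{(2k,2m)}(e_j,e_l)=\varepsilon_j\delta_{jl}$). *)

(* Defs.v *)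
From HB Require Import structures.
From mathcomp Require Import all_boot all_order all_algebra.
From mathcomp Require Import all_classical all_reals all_analysis.
From mathcomp Require Import complex.
Set Implicit Arguments.
Unset Strict Implicit.
Unset Printing Implicit Defensive.
Import Order.TTheory GRing.Theory Num.Theory.
Import numFieldNormedType.Exports.
Local Open Scope classical_set_scope.
Local Open Scope ring_scope.

(* f is of class C^r on A, which is meant to be open. In the successor case all
   the directional derivatives of f are required to be of class C^(r-1); for a
   finite-dimensional U this is the usual notion. *)
Fixpoint class_C (R : realType) (U W : normedModType R) (r : nat)
    (A : set U) (f : U -> W) : Prop :=
  match r with
  | 0 => forall x, A x -> {for x, continuous f}
  | r'.+1 => (forall x, A x -> differentiable f x) /\
             (forall v, class_C r' A (fun x => 'D_v f x))
  end.

Definition smooth_on (R : realType) (U W : normedModType R)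
    (A : set U) (f : U -> W) : Prop :=
  forall r, class_C r A f.

Section Submanifolds.
Variables (R : realType) (E : normedModType R) (d : nat).
Implicit Types (M : set E) (p v : E).

(* phi restricts to a smooth immersion of V which is a homeomorphism (with
   inverse psi) onto an open subset of M, for the subspace topology. *)
Definition local_param M (V : set 'rV[R]_d) (phi : 'rV[R]_d -> E) : Prop :=
  [/\ open V, smooth_on V phi, (forall x, V x -> injective ('d phi x)) &
    exists (U : set E) (psi : E -> 'rV[R]_d),
      [/\ open U, phi @` V = M `&` U, {in V, cancel phi psi} &
          {within M `&` U, continuous psi}]].

(* The empty set is a submanifold of every dimension. *)
Definition submanifold M : Prop :=
  forall p, M p -> exists (V : set 'rV[R]_d) (phi : 'rV[R]_d -> E),
    local_param M V phi /\ (phi @` V) p.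

(* velocities at p of the smooth curves in M through p *)
Definition tangent M p v : Prop :=
  exists (gamma : R -> E) (r : R),
    [/\ 0 < r, smooth_on (ball (0 : R) r) gamma,
        (forall t, ball (0 : R) r t -> M (gamma t)),
        gamma 0 = p & 'D_1 gamma 0 = v].

Definition frame_comb (e : 'I_d -> E) (a : 'rV[R]_d) : E :=
  \sum_(i < d) a ord0 i *: e i.

Definition is_basis (T : E -> Prop) (e : 'I_d -> E) : Prop :=
  (forall v, T v <-> exists a, v = frame_comb e a) /\
  injective (frame_comb e).

Definition same_orientation (e f : 'I_d -> E) : Prop :=
  exists A : 'M[R]_d, 0 < \det A /\ forall i, f i = frame_comb e (row i A).

(* O p e reads: e is a positively oriented basis of the tangent space of M
   at p. The last clause is the continuity of this choice in p. *)
Definition orientation M (O : E -> ('I_d -> E) -> Prop) : Prop :=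
  forall p, M p ->
    (exists e0, is_basis (tangent M p) e0 /\
       forall e, O p e <-> is_basis (tangent M p) e /\ same_orientation e0 e) /\
    (exists (V : set 'rV[R]_d) (phi : 'rV[R]_d -> E),
       [/\ local_param M V phi, (phi @` V) p &
           forall x, V x -> O (phi x) (fun i => 'd phi x (delta_mx ord0 i))]).

End Submanifolds.

(* C^m = R^2m: the pair (x, y) stands for the point x + iy. *)
Notation Cspace R m := ('rV[R]_m * 'rV[R]_m)%type.

Section IndefiniteComplexSpace.
Variables (R : realType) (m k : nat).
Implicit Types (u v : Cspace R m) (M : set (Cspace R m)).

Definition zcoord u (j : 'I_m) : R[i] := Complex (u.1 ord0 j) (u.2 ord0 j).

(* Indices start at 0, so the first k coordinates are those with j < k. *)
Definition eps (j : 'I_m) : R := if (j < k)%N then -1 else 1.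

Definition gmetric u v : R :=
  \sum_(j < m) eps j * (u.1 ord0 j * v.1 ord0 j + u.2 ord0 j * v.2 ord0 j).

Definition omega u v : R :=
  \sum_(j < m) eps j * (u.1 ord0 j * v.2 ord0 j - u.2 ord0 j * v.1 ord0 j).

(* the complex volume form dz_1 /\ ... /\ dz_m *)
Definition dz (e : 'I_m -> Cspace R m) : R[i] :=
  \det (\matrix_(i < m, j < m) zcoord (e i) j).

Definition lagrangian M : Prop :=
  [/\ submanifold m M,
      (forall p, M p -> forall u v, tangent M p u -> tangent M p v ->
         omega u v = 0) &
      (forall p, M p -> forall u, tangent M p u ->
         (forall v, tangent M p v -> gmetric u v = 0) -> u = 0)].

Definition lorentz_basis M (p : Cspace R m) (e : 'I_m -> Cspace R m) : Prop :=
  is_basis (tangent M p) e /\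
  forall j l, gmetric (e j) (e l) = if j == l then eps j else 0.

Definition special_lagrangian M
    (O : Cspace R m -> ('I_m -> Cspace R m) -> Prop) : Prop :=
  [/\ lagrangian M, orientation M O &
      forall p, M p -> forall e, lorentz_basis M p e -> O p e -> dz e = 1].

Definition Mc (s c : R) : set (Cspace R m) :=
  [set z | exists (t : 'rV[R]_m) (lambda : R[i]),
     [/\ \sum_(j < m) eps j * t ord0 j ^+ 2 = s,
         lambda != 0,
         complex.Im (lambda ^+ m) = c &
         forall j, zcoord z j = lambda * Complex (t ord0 j) 0]].

End IndefiniteComplexSpace.

(* Main.v *)
(* With q(u) = sum_j eps_j u_j^2, the tangent space of M_c at p = l t, q(t) = s, is
   spanned by l u, where u is q-orthogonal to t, and by l^(1-m) t, because the curve
   Im l^m = c has direction l^(1-m).  Normalising l to modulus one, this is the image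
   of R^m under the complex matrix acting as l on the q-orthogonal of t and as
   l^(1-m) on t.  That matrix has determinant l^(m-1) l^(1-m) = 1 and preserves the
   hermitian extension of q, so the tangent space inherits from R^m the real form q,
   omega vanishes on it, and dz takes the values det U, with U a real matrix which is
   q-orthogonal when the basis is a Lorentz basis.  M_c is orientated by Re dz > 0.

   Charts: near p some t_j0 is nonzero; the coordinates are the other t_j and
   Re l^m in place of t_j0.  The parameters (l, t) are recovered from the point z by
   l^2 = s q(z), which determines (l, t) up to a common sign. *)

Require Import Defs.
From HB Require Import structures.
From mathcomp Require Import all_boot all_order all_algebra.
From mathcomp Require Import all_classical all_reals all_analysis.
From mathcomp Require Import complex.
From mathcomp Require Import ring lra.
Set Implicit Arguments.
Unset Strict Implicit.
Unset Printing Implicit Defensive.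
Import Order.TTheory GRing.Theory Num.Theory.
Import numFieldNormedType.Exports.
Local Open Scope classical_set_scope.
Local Open Scope ring_scope.

(** * Smooth functions *)

(** The obstacle is to control M_c as a subset of C^m: tangent vectors are velocities of arbitrary
    curves in it, and a chart must be a homeomorphism onto its image. Both are settled by an inverse
    of the chart that is smooth on an open set of C^m: its restriction to M_c is continuous, and
    every smooth curve in M_c factors through the chart. Roots are taken after division by their
    value at the base point, so that the argument stays near 1 and the principal branch is smooth.
    The pairs (l, t) and (-l, -t) give the same point z, but for odd m they have opposite l^m. If c
    is nonzero, the sign of Im l^m therefore decides between them near p; if c = 0, both are
    admissible. The exponent m in Im l^m = c is the dimension: along this curve l^(m-1) dl is real,
    and l^(1-m) compensates the determinant of l on the (m-1)-dimensional orthogonal of t. *)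

Section Calculus.
Variable R : realType.
Implicit Types (U V W : normedModType R) (r : nat).

Lemma near_eq_differentiable U W (f g : U -> W) (x : U) :
  (\near x, f x = g x) -> differentiable f x -> differentiable g x.
Proof.
move=> fg df.
(* The difference vanishes near x, so its differential is 0, and g is recovered as a sum of
   differentiable functions. *)
suff dh : differentiable (g - f) x.
  by rewrite (_ : g = f + (g - f)); [exact: differentiableD | rewrite addrC subrK].
apply/diff_locallyP.
have zC : continuous (\0 : {linear U -> W}) by exact: cst_continuous.
have ho : (g - f) \o shift x = cst ((g - f) x) + (\0 : U -> W) +o_ 0 id.
  apply/eqaddoP => e e0.
  have : \forall y \near 0, f (y + x) = g (y + x).
    have := fg; rewrite (near_shift 0) /=.
    by apply: filterS => y /=; rewrite subr0.
  apply: filterS => y fgy /=.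
  rewrite !fctE /= fgy (nbhs_singleton fg) !subrr !addr0 subr0 normr0.
  by rewrite mulr_ge0 // ltW.
by rewrite (diff_unique zC ho).
Qed.

(** Regularity on an open set is local. In the inductions below this replaces a derivative by the
    formula of a derivation rule, which holds only on [A]. *)
Lemma class_C_eq U W r (A : set U) (f g : U -> W) :
  open A -> (forall x, A x -> f x = g x) -> class_C r A f -> class_C r A g.
Proof.
move=> oA; elim: r f g => [|r IH] f g fg /=.
  move=> fC x Ax; have nf : \near x, f x = g x.
    by apply: filterS (open_nbhs_nbhs (conj oA Ax)).
  move: (fC _ Ax); rewrite /prop_for /continuous_at (fg _ Ax).
  by apply: cvg_trans; apply: near_eq_cvg.
case=> fd fD; have nf x : A x -> \near x, f x = g x.
  by move=> Ax; apply: filterS (open_nbhs_nbhs (conj oA Ax)).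
split=> [x Ax|v]; first exact: near_eq_differentiable (nf _ Ax) (fd _ Ax).
apply: IH (fD v) => x Ax; exact/near_eq_derive/nf.
Qed.

Lemma class_CW U W r (A : set U) (f : U -> W) :
  class_C r.+1 A f -> class_C r A f.
Proof.
elim: r f => [|r IH] f [fd fD] /=.
  by move=> x Ax; exact/differentiable_continuous/fd.
by split=> // v; exact/IH/fD.
Qed.

Lemma class_C_sub U W r (A B : set U) (f : U -> W) :
  A `<=` B -> class_C r B f -> class_C r A f.
Proof.
move=> AB; elim: r f => [|r IH] f /=; first by move=> fC x /AB/fC.
by case=> fd fD; split=> [x /AB/fd //|v]; exact: IH.
Qed.

Lemma class_C_cst U W r (A : set U) (a : W) : class_C r A (cst a).
Proof.
elim: r a => [|r IH] a /=; first by move=> x _; exact: cst_continuous.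
split=> // v; rewrite (_ : (fun _ => _) = cst 0); first exact: IH.
by apply/funext => x; rewrite derive_cst.
Qed.

Lemma class_C_D U W r (A : set U) (f g : U -> W) :
  open A -> class_C r A f -> class_C r A g -> class_C r A (f + g).
Proof.
move=> oA; elim: r f g => [|r IH] f g /=.
  by move=> fC gC x Ax; apply: continuousD; [exact: fC|exact: gC].
case=> fd fD [gd gD]; split=> [x Ax|v].
  by apply: differentiableD; [exact: fd|exact: gd].
apply: class_C_eq (IH _ _ (fD v) (gD v)) => // x Ax.
by rewrite deriveD //; apply: diff_derivable; [exact: fd|exact: gd].
Qed.

Lemma class_C_M U r (A : set U) (f g : U -> R) :
  open A -> class_C r A f -> class_C r A g -> class_C r A (f * g).
Proof.
move=> oA; elim: r f g => [|r IH] f g.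
  by move=> fC gC x Ax; apply: continuousM; [exact: fC|exact: gC].
move=> fC gC; have [[fd fD] [gd gD]] := (fC, gC).
split=> [x Ax|v].
  by apply: differentiableM; [exact: fd|exact: gd].
apply: (@class_C_eq _ _ _ _ (f * (fun x => 'D_v g x) + g * (fun x => 'D_v f x))) => // [x Ax|].
  have [fx gx] : derivable f x v /\ derivable g x v.
    by split; apply/diff_derivable; [exact: fd|exact: gd].
  exact/esym/deriveM.
(* The Leibniz rule returns [f] and [g] undifferentiated; being of class C^(r+1), they are lowered
   to C^r for the induction hypothesis. *)
by apply: class_C_D => //; apply: IH; [exact: class_CW|exact: gD|exact: class_CW|exact: fD].
Qed.

Lemma derive_linear_comp U V W (l : {linear V -> W}) (f : U -> V) (x v : U) :
  continuous l -> differentiable f x -> 'D_v (l \o f) x = l ('D_v f x).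
Proof.
move=> lC fd; have ld y : differentiable l y by exact: linear_differentiable.
rewrite deriveE; last exact: differentiable_comp.
by rewrite diff_comp //= diff_lin // deriveE.
Qed.

Lemma class_C_linear_comp U V W r (A : set U) (l : {linear V -> W}) (f : U -> V) :
  open A -> continuous l -> class_C r A f -> class_C r A (l \o f).
Proof.
move=> oA lC; have ld y : differentiable l y by exact: linear_differentiable.
elim: r f => [|r IH] f /=.
  by move=> fC x Ax; apply: continuous_comp; [exact: fC|exact: lC].
case=> fd fD; split=> [x Ax|v].
  by apply: differentiable_comp; [exact: fd|exact: ld].
apply: class_C_eq (IH _ (fD v)) => // x Ax.
by rewrite derive_linear_comp //; exact: fd.
Qed.

Lemma is_diff_affine U V (a : V) (l : {linear U -> V}) (y : U) :
  continuous l -> is_diff y (fun x => a + l x) l.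
Proof.
move=> lC; have dl : is_diff y l l.
  by apply: DiffDef; [exact: linear_differentiable|exact: diff_lin].
have := is_diffD (is_diff_cst a y) dl.
by rewrite add0r.
Qed.

(** Serves for the lines x + t a in a parameter domain. Differentiating along [v] gives the
    derivative of [f] along [l v], again composed with the same affine map, so the induction
    closes. *)
Lemma class_C_affine_comp U V W r (A : set V) (a : V) (l : {linear U -> V}) (f : V -> W) :
  open A -> continuous l -> class_C r A f ->
  class_C r [set x | A (a + l x)] (f \o (fun x => a + l x)).
Proof.
move=> oA lC; have ld (y : U) := is_diff_affine a y lC.
have aC : continuous (fun x => a + l x).
  by move=> x; apply: differentiable_continuous.
have oA' : open [set x | A (a + l x)].
  by apply: (@open_comp _ _ (fun x => a + l x)) => // x _; exact: aC.
elim: r f => [|r IH] f /=.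
  by move=> fC x Ax; apply: continuous_comp; [exact: aC|exact: fC].
case=> fd fD; split=> [x Ax|v].
  by apply: differentiable_comp => //; exact: fd.
apply: class_C_eq (IH _ (fD (l v))) => // x /= Ax.
rewrite [RHS]deriveE; last by apply: differentiable_comp => //; exact: fd.
by rewrite diff_comp //=; [rewrite diff_val deriveE //; exact: fd | exact: fd].
Qed.

Lemma class_C_sum U W r (A : set U) (I : Type) (s : seq I) (P : pred I) (f : I -> U -> W) :
  open A -> (forall i, P i -> class_C r A (f i)) ->
  class_C r A (fun x => \sum_(i <- s | P i) f i x).
Proof.
move=> oA fC; elim: s => [|i s IH].
  by rewrite (_ : (fun _ => _) = cst 0); [exact: class_C_cst|apply/funext=> x; rewrite big_nil].
case Pi: (P i); last first.
  by rewrite (_ : (fun _ => _) = (fun x => \sum_(i <- s | P i) f i x)) //;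
     apply/funext=> x; rewrite big_cons Pi.
rewrite (_ : (fun _ => _) = f i + (fun x => \sum_(i <- s | P i) f i x)).
  by apply: class_C_D => //; exact: fC.
by apply/funext=> x; rewrite big_cons Pi.
Qed.

(** Outer functions of one real variable suffice: complex quotients and roots are assembled below
    from real inverses, [expR], [ln], [atan], [cos] and [sin]. *)
Lemma class_C_comp U r (A : set U) (B : set R) (h : R -> R) (f : U -> R) :
  open A -> (forall x, A x -> B (f x)) -> class_C r B h -> class_C r A f ->
  class_C r A (h \o f).
Proof.
move=> oA AB; elim: r h f AB => [|r IH] h f AB.
  move=> hC fC x Ax; apply: continuous_comp; [exact: fC|exact/hC/AB].
move=> [hd hD] fC; have [fd fD] := fC; split=> [x Ax|v].
  by apply: differentiable_comp; [exact: fd|exact/hd/AB].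
apply: (@class_C_eq _ _ _ _ ((fun x => 'D_v f x) * ((fun y => 'D_1 h y) \o f))) => //.
  move=> x Ax; rewrite [RHS]deriveE; last first.
    by apply: differentiable_comp; [exact: fd|exact/hd/AB].
  rewrite diff_comp /=; [|exact: fd|exact/hd/AB].
  rewrite !fctE deriveE; last exact: fd.
  rewrite deriveE; last exact/hd/AB.
  by rewrite -[X in _ = 'd h _ X]mulr1 linearZ.
by apply: class_C_M => //; [exact: fD|apply: (IH _ _ AB (hD 1)); exact: class_CW].
Qed.

Lemma smooth_on_eq U W (A : set U) (f g : U -> W) :
  open A -> (forall x, A x -> f x = g x) -> smooth_on A f -> smooth_on A g.
Proof. by move=> oA fg fS r; apply: class_C_eq (fS r). Qed.

Lemma smooth_on_sub U W (A B : set U) (f : U -> W) :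
  A `<=` B -> smooth_on B f -> smooth_on A f.
Proof. by move=> AB fS r; apply: class_C_sub (fS r). Qed.

Lemma smooth_on_differentiable U W (A : set U) (f : U -> W) x :
  smooth_on A f -> A x -> differentiable f x.
Proof. by move=> /(_ 1%N)[fd _]; exact: fd. Qed.

Lemma smooth_on_continuous U W (A : set U) (f : U -> W) x :
  smooth_on A f -> A x -> {for x, continuous f}.
Proof. by move=> /(_ 0%N); apply. Qed.

Lemma smooth_on_cst U W (A : set U) (a : W) : smooth_on A (fun _ => a).
Proof. by move=> r; exact: class_C_cst. Qed.

Lemma smooth_on_linear U W (A : set U) (l : {linear U -> W}) :
  continuous l -> smooth_on A l.
Proof.
move=> lC; have ld y : differentiable l y by exact: linear_differentiable.
case=> [|r]; first by move=> x _; exact: lC.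
split=> // v; rewrite (_ : (fun _ => _) = cst (l v)); first exact: class_C_cst.
by apply/funext => x; rewrite deriveE // diff_lin.
Qed.

Section Scalar.
Variables (U : normedModType R) (A : set U).
Hypothesis oA : open A.
Implicit Types f g : U -> R.

Lemma smooth_onD W (f g : U -> W) :
  smooth_on A f -> smooth_on A g -> smooth_on A (fun x => f x + g x).
Proof. by move=> fS gS r; exact: class_C_D. Qed.

Lemma smooth_onM f g :
  smooth_on A f -> smooth_on A g -> smooth_on A (fun x => f x * g x).
Proof. by move=> fS gS r; exact: class_C_M. Qed.

Lemma smooth_onN f : smooth_on A f -> smooth_on A (fun x => - f x).
Proof.
move=> fS; rewrite (_ : (fun _ => _) = (fun x => (-1) * f x)).
  by apply: smooth_onM => //; exact: smooth_on_cst.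
by apply/funext => x; rewrite mulN1r.
Qed.

Lemma smooth_onB f g :
  smooth_on A f -> smooth_on A g -> smooth_on A (fun x => f x - g x).
Proof. by move=> fS gS; apply: smooth_onD => //; exact: smooth_onN. Qed.

Lemma smooth_onX f n : smooth_on A f -> smooth_on A (fun x => f x ^+ n).
Proof.
move=> fS; elim: n => [|n IH].
  by under eq_fun do rewrite expr0; exact: smooth_on_cst.
by under eq_fun do rewrite exprS; exact: smooth_onM.
Qed.

Lemma smooth_on_sum W (I : Type) (s : seq I) (P : pred I) (f : I -> U -> W) :
  (forall i, P i -> smooth_on A (f i)) ->
  smooth_on A (fun x => \sum_(i <- s | P i) f i x).
Proof. by move=> fS r; apply: class_C_sum => // i /fS. Qed.

Lemma smooth_on_comp (B : set R) (h : R -> R) f :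
  (forall x, A x -> B (f x)) -> smooth_on B h -> smooth_on A f ->
  smooth_on A (fun x => h (f x)).
Proof. by move=> AB hS fS r; apply: (class_C_comp oA AB). Qed.

End Scalar.

(* Bootstraps the regularity of h when h' is a smooth expression in h itself. *)
Lemma smooth_on_bootstrap (B : set R) (h h' : R -> R) :
  open B -> (forall x, B x -> is_derive x (1 : R) h (h' x)) ->
  (forall r, class_C r B h -> class_C r B h') -> smooth_on B h.
Proof.
move=> oB dh hh'; have hd x : B x -> differentiable h x.
  by move=> /dh dhx; apply/derivable1_diffP; exact: ex_derive.
elim=> [|r IH]; first by move=> x Bx; exact/differentiable_continuous/hd.
split=> // v.
apply: (@class_C_eq _ _ _ _ (cst v * h')) => //; last first.
  by apply: class_C_M => //; [exact: class_C_cst|exact: hh'].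
move=> x Bx; rewrite [RHS]deriveE; last exact: hd.
rewrite -[X in _ = 'd h _ X]mulr1 linearZ /= -deriveE; last exact: hd.
by have [_ ->] := dh _ Bx.
Qed.

(** * Elementary functions of one real variable *)

Lemma smooth_inv (B : set R) : open B -> (forall x, B x -> x != 0) ->
  smooth_on B (@GRing.inv R).
Proof.
move=> oB B0; apply: (@smooth_on_bootstrap _ _ (fun x => - (x^-1 * x^-1))) => //.
  move=> x /B0 x0; have := @is_derive_id _ _ x (1:R).
  have dV : derivable (fun x : R => x^-1) x 1 by exact: derivableV.
  move=> _; apply: DeriveDef => //; rewrite deriveV // derive_id.
  by rewrite /GRing.scale /= mulr1 expr2 invfM.
move=> r hS; rewrite (_ : (fun _ => _) = cst (-1) * (@GRing.inv R * @GRing.inv R)).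
  by apply: class_C_M; [|exact: class_C_cst|exact: class_C_M].
by apply/funext => x; rewrite !fctE mulN1r.
Qed.

Lemma smooth_expR (B : set R) : open B -> smooth_on B expR.
Proof. by move=> oB; apply: (@smooth_on_bootstrap _ _ expR). Qed.

Lemma smooth_ln (B : set R) : open B -> (forall x, B x -> 0 < x) ->
  smooth_on B (@ln R).
Proof.
move=> oB B0; apply: (@smooth_on_bootstrap _ _ (@GRing.inv R)) => //.
  by move=> x /B0 x0; exact: is_derive1_ln.
by move=> r _; apply: smooth_inv => // x /B0; exact: lt0r_neq0.
Qed.

(** Each function is the derivative of the other up to sign, so the induction on the class treats
    both together. *)
Lemma smooth_cos_sin (B : set R) : open B ->
  smooth_on B (@cos R) /\ smooth_on B (@sin R).
Proof.
move=> oB; suff cs r : class_C r B (@cos R) /\ class_C r B (@sin R).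
  by split=> r; have [] := cs r.
have ds (x : R) : differentiable (@sin R) x by apply/derivable1_diffP/derivable_sin.
have dc (x : R) : differentiable (@cos R) x by apply/derivable1_diffP/derivable_cos.
elim: r => [|r [cC sC]].
  by split=> x _; [exact: continuous_cos|exact: continuous_sin].
split; split=> // v.
- apply: (@class_C_eq _ _ _ _ (cst (- v) * @sin R)) => //; last first.
    by apply: class_C_M => //; exact: class_C_cst.
  move=> x _; rewrite [RHS]deriveE // -[X in _ = 'd _ _ X]mulr1 linearZ /=.
  rewrite -deriveE //; have [_ ->] := is_derive_cos x.
  by rewrite !fctE mulNr -mulrN.
- apply: (@class_C_eq _ _ _ _ (cst v * @cos R)) => //; last first.
    by apply: class_C_M => //; exact: class_C_cst.
  move=> x _; rewrite [RHS]deriveE // -[X in _ = 'd _ _ X]mulr1 linearZ /=.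
  by rewrite -deriveE //; have [_ ->] := is_derive_sin x.
Qed.

Lemma smooth_atan (B : set R) : open B -> smooth_on B (@atan R).
Proof.
move=> oB; apply: (@smooth_on_bootstrap _ _ (fun x => (1 + x ^+ 2)^-1)) => //.
move=> r _.
have oP : open [set x : R | 0 < x] by exact: open_gt.
apply: (@smooth_on_comp _ _ oB _ (@GRing.inv R) (fun x => 1 + x ^+ 2) _ (smooth_inv oP _)).
- by move=> x _ /=; rewrite ltr_pwDl // sqr_ge0.
- by move=> x /= /lt0r_neq0.
- apply: smooth_onD => //; first exact: smooth_on_cst.
  apply: smooth_onX => //.
  by apply: (@smooth_on_linear _ _ _ idfun) => x; exact: cvg_id.
Qed.

Section DerivativeRules.
Variables (U : normedModType R) (A : set U) (x v : U).
Hypothesis Ax : A x.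

Lemma smooth_derivable (f : U -> R) : smooth_on A f -> derivable f x v.
Proof. by move=> fS; apply/diff_derivable; exact: smooth_on_differentiable fS Ax. Qed.

Lemma derive_smoothM (f g : U -> R) : smooth_on A f -> smooth_on A g ->
  'D_v (fun y => f y * g y) x = f x * 'D_v g x + g x * 'D_v f x.
Proof.
by move=> fS gS; exact: (deriveM (smooth_derivable fS) (smooth_derivable gS)).
Qed.

Lemma derive_smoothMl (a : R) (f : U -> R) : smooth_on A f ->
  'D_v (fun y => a * f y) x = a * 'D_v f x.
Proof.
move=> fS; rewrite (derive_smoothM (smooth_on_cst A a) fS).
by rewrite (derive_cst a) mulr0 addr0.
Qed.

Lemma derive_smooth_sum n (f : 'I_n -> U -> R) : (forall j, smooth_on A (f j)) ->
  'D_v (fun y => \sum_j f j y) x = \sum_j 'D_v (f j) x.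
Proof.
move=> fS; rewrite (_ : (fun _ => _) = \sum_j f j); last first.
  by apply/funext => y; rewrite fct_sumE.
by rewrite derive_sum // => j; exact: smooth_derivable (fS j).
Qed.

End DerivativeRules.

End Calculus.

(** * Complex-valued functions and roots *)

Section ComplexValued.
Variable R : realType.
Local Notation Re := (@complex.Re R).
Local Notation Im := (@complex.Im R).
Local Notation "x %:C" := (real_complex R x).
Implicit Types w z : R[i].

Lemma complex_eqP z w : Re z = Re w -> Im z = Im w -> z = w.
Proof. by case: z w => a b [c d] /= -> ->. Qed.

Lemma ReD z w : Re (z + w) = Re z + Re w.
Proof. by case: z w => a b [c d]. Qed.

Lemma ImD z w : Im (z + w) = Im z + Im w.
Proof. by case: z w => a b [c d]. Qed.

Lemma ReM z w : Re (z * w) = Re z * Re w - Im z * Im w.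
Proof. by case: z w => a b [c d]. Qed.

Lemma ImM z w : Im (z * w) = Re z * Im w + Im z * Re w.
Proof. by case: z w => a b [c d]. Qed.

Lemma ReV z : Re z^-1 = Re z / (Re z ^+ 2 + Im z ^+ 2).
Proof. by case: z. Qed.

Lemma ImV z : Im z^-1 = - Im z / (Re z ^+ 2 + Im z ^+ 2).
Proof. by case: z => a b /=; rewrite mulNr. Qed.

Lemma Re_sum (I : Type) (r : seq I) (P : pred I) (F : I -> R[i]) :
  Re (\sum_(i <- r | P i) F i) = \sum_(i <- r | P i) Re (F i).
Proof. by apply: (big_morph Re ReD). Qed.

Lemma Im_sum (I : Type) (r : seq I) (P : pred I) (F : I -> R[i]) :
  Im (\sum_(i <- r | P i) F i) = \sum_(i <- r | P i) Im (F i).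
Proof. by apply: (big_morph Im ImD). Qed.

Lemma sqr_Re_Im_gt0 z : z != 0 -> 0 < Re z ^+ 2 + Im z ^+ 2.
Proof.
move=> z0; rewrite lt_def addr_ge0 ?sqr_ge0 // andbT.
rewrite paddr_eq0 ?sqr_ge0 // !sqrf_eq0; apply: contra z0 => /andP[/eqP a0 /eqP b0].
by apply/eqP/complex_eqP.
Qed.

Lemma Re_gt0_neq0 z : 0 < Re z -> z != 0.
Proof. by apply: contraTneq => -> /=; rewrite ltxx. Qed.

Lemma eq_sqr_Re_gt0 z w : 0 < Re z -> 0 < Re w -> z ^+ 2 = w ^+ 2 -> z = w.
Proof.
move=> z0 w0 /eqP; rewrite eqf_sqr => /orP[/eqP //|/eqP zw].
by move: z0; rewrite zw; case: w w0 {zw} => a b /= a0; rewrite oppr_gt0 ltNge ltW.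
Qed.

(** Regularity is read off the real and imaginary parts, so [R[i]] never has to be a normed space
    over [R]. *)
Definition csmooth (U : normedModType R) (A : set U) (f : U -> R[i]) : Prop :=
  smooth_on A (fun x => Re (f x)) /\ smooth_on A (fun x => Im (f x)).

Definition cderive (U : normedModType R) (v : U) (f : U -> R[i]) (x : U) : R[i] :=
  Complex ('D_v (fun y => Re (f y)) x) ('D_v (fun y => Im (f y)) x).

Section Calculus.
Variables (U : normedModType R) (A : set U).
Hypothesis oA : open A.
Implicit Types f g : U -> R[i].

Lemma csmooth_cst z : csmooth A (fun _ => z).
Proof. by split; exact: smooth_on_cst. Qed.

Lemma csmooth_real (f : U -> R) : smooth_on A f -> csmooth A (fun x => (f x)%:C).
Proof. by move=> fS; split=> //=; exact: smooth_on_cst. Qed.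

Lemma csmoothM f g : csmooth A f -> csmooth A g -> csmooth A (fun x => f x * g x).
Proof.
move=> [f1 f2] [g1 g2]; split.
  by under eq_fun do rewrite ReM; apply: smooth_onB => //; exact: smooth_onM.
by under eq_fun do rewrite ImM; apply: smooth_onD => //; exact: smooth_onM.
Qed.

Lemma csmoothX f n : csmooth A f -> csmooth A (fun x => f x ^+ n).
Proof.
move=> fS; elim: n => [|n IH].
  by under eq_fun do rewrite expr0; exact: csmooth_cst.
by under eq_fun do rewrite exprS; exact: csmoothM.
Qed.

Lemma csmooth_sum (I : Type) (s : seq I) (P : pred I) (f : I -> U -> R[i]) :
  (forall i, P i -> csmooth A (f i)) ->
  csmooth A (fun x => \sum_(i <- s | P i) f i x).
Proof.
move=> fS; split.
  under eq_fun do rewrite Re_sum.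
  by apply: smooth_on_sum => // i /fS[].
under eq_fun do rewrite Im_sum.
by apply: smooth_on_sum => // i /fS[].
Qed.

Lemma smooth_onV (f : U -> R) : (forall x, A x -> 0 < f x) ->
  smooth_on A f -> smooth_on A (fun x => (f x)^-1).
Proof.
move=> f0 fS; have oP : open [set x : R | 0 < x] by exact: open_gt.
apply: (smooth_on_comp oA f0 (smooth_inv oP _) fS) => x /= x0.
exact: lt0r_neq0.
Qed.

Lemma csmoothV f : (forall x, A x -> f x != 0) ->
  csmooth A f -> csmooth A (fun x => (f x)^-1).
Proof.
move=> f0 [f1 f2].
have nS : smooth_on A (fun x => (Re (f x) ^+ 2 + Im (f x) ^+ 2)^-1).
  apply: smooth_onV; first by move=> x /f0; exact: sqr_Re_Im_gt0.
  by apply: smooth_onD => //; exact: smooth_onX.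
split.
  by under eq_fun do rewrite ReV; exact: smooth_onM.
under eq_fun do rewrite ImV; apply: smooth_onM => //; exact: smooth_onN.
Qed.

Lemma near_eq_cderive f g x v :
  (\near x, f x = g x) -> cderive v f x = cderive v g x.
Proof.
by move=> fg; congr Complex; apply: near_eq_derive; apply: filterS fg => y ->.
Qed.

Lemma cderiveM f g x v : A x -> csmooth A f -> csmooth A g ->
  cderive v (fun y => f y * g y) x = cderive v f x * g x + f x * cderive v g x.
Proof.
move=> Ax [f1 f2] [g1 g2].
have D (h : U -> R) : smooth_on A h -> derivable h x v.
  exact: smooth_derivable.
have DM := derive_smoothM v Ax.
have MS := smooth_onM oA.
apply: complex_eqP; rewrite /cderive.
  under [fun y => Re _]eq_fun do rewrite ReM.
  have -> := deriveB (D _ (MS _ _ f1 g1)) (D _ (MS _ _ f2 g2)).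
  by rewrite (DM _ _ f1 g1) (DM _ _ f2 g2) ReD !ReM /=; ring.
under [fun y => Im _]eq_fun do rewrite ImM.
have -> := deriveD (D _ (MS _ _ f1 g2)) (D _ (MS _ _ f2 g1)).
by rewrite (DM _ _ f1 g2) (DM _ _ f2 g1) ImD !ImM /=; ring.
Qed.

Lemma cderive_cst z x v : cderive v (fun _ : U => z) x = 0.
Proof. by rewrite /cderive !derive_cst. Qed.

Lemma cderiveX f n x v : A x -> csmooth A f ->
  cderive v (fun y => f y ^+ n) x = n%:R * f x ^+ n.-1 * cderive v f x.
Proof.
move=> Ax fS; elim: n => [|n IH].
  by under [fun y => _]eq_fun do rewrite expr0; rewrite cderive_cst !mul0r.
under [fun y => _]eq_fun do rewrite exprS.
rewrite cderiveM //; last exact: csmoothX.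
rewrite IH -natr1; case: n {IH} => [|n] /=; first by rewrite expr0; ring.
by rewrite exprS; ring.
Qed.

End Calculus.

(** * Branches of complex roots *)

Definition cis (b : R) : R[i] := Complex (cos b) (sin b).

Lemma cisX b n : cis b ^+ n = cis (b *+ n).
Proof.
elim: n => [|n IH]; first by rewrite expr0 mulr0n /cis cos0 sin0.
rewrite exprS IH mulrS; apply: complex_eqP; rewrite ?ReM ?ImM /= ?cosD ?sinD //.
by rewrite addrC.
Qed.

(* The principal branch of the n-th root on the right half-plane, in polar
   form: w = (Re w / cos b) e^(ib) with b = atan (Im w / Re w). *)
Definition croot n w : R[i] :=
  let b := atan (Im w / Re w) in
  (expR (ln (Re w / cos b) / n%:R))%:C * cis (b / n%:R).

Lemma cos_atan_gt0 (x : R) : 0 < cos (atan x).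
Proof. by apply: cos_gt0_pihalf; rewrite atan_gtNpi2 atan_ltpi2. Qed.

Lemma crootX n w : (0 < n)%N -> 0 < Re w -> croot n w ^+ n = w.
Proof.
move=> n0 w0; rewrite /croot; set b := atan _.
have n1 : n%:R != 0 :> R by rewrite pnatr_eq0 -lt0n.
have nE (x : R) : x / n%:R *+ n = x by rewrite -mulr_natr divfK.
have cb : 0 < cos b by exact: cos_atan_gt0.
rewrite exprMn cisX nE -rmorphXn /= -expRM_natl.
rewrite mulr_natl nE lnK ?posrE ?divr_gt0 //.
have tb : sin b / cos b = Im w / Re w by rewrite -[LHS]/(tan b) atanK.
have w1 := lt0r_neq0 w0; have cb1 := lt0r_neq0 cb.
have sb : sin b = Im w / Re w * cos b by rewrite -tb divfK.
by apply: complex_eqP; rewrite ?ReM ?ImM /= ?sb; field; rewrite ?w1 ?cb1.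
Qed.

(** The angle is an arctangent divided by n >= 1, hence stays in ]-pi/2, pi/2[ for every [w]. This
    makes [lchart] and [linv] nonzero everywhere. *)
Lemma Re_croot_gt0 n w : (0 < n)%N -> 0 < Re (croot n w).
Proof.
move=> n0; rewrite /croot; set b := atan _.
rewrite ReM /= mul0r subr0 mulr_gt0 ?expR_gt0 //.
have bl : - (pi / 2) < b by exact: atan_gtNpi2.
have br : b < pi / 2 by exact: atan_ltpi2.
have n1 : 1 <= n%:R :> R by rewrite ler1n.
have n2 : 0 < n%:R :> R by rewrite ltr0n.
have pi0 : 0 < pi / 2 :> R by rewrite divr_gt0 // pi_gt0.
apply: cos_gt0_pihalf; apply/andP; split.
  by rewrite ltr_pdivlMr //; nra.
by rewrite ltr_pdivrMr //; nra.
Qed.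

Lemma croot1 n : croot n 1 = 1.
Proof.
rewrite /croot /= mul0r atan0 cos0 divr1 ln1 !mul0r expR0 /cis cos0 sin0.
by rewrite mul1r.
Qed.

Lemma csmooth_croot (U : normedModType R) (A : set U) n (f : U -> R[i]) :
  open A -> (forall x, A x -> 0 < Re (f x)) -> csmooth A f ->
  csmooth A (fun x => croot n (f x)).
Proof.
move=> oA f0 [f1 f2].
have oP : open [set x : R | 0 < x] by exact: open_gt.
have oT : open [set: R] by exact: openT.
have V1 := smooth_onV oA f0 f1.
have bS : smooth_on A (fun x => atan (Im (f x) / Re (f x))).
  apply: (smooth_on_comp oA (B := setT)) => //; first exact: smooth_atan.
  exact: smooth_onM.
have bnS : smooth_on A (fun x => atan (Im (f x) / Re (f x)) / n%:R).
  by apply: smooth_onM => //; exact: smooth_on_cst.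
apply: csmoothM => //.
  apply: csmooth_real.
  apply: (smooth_on_comp oA (B := setT)) => //; first exact: smooth_expR.
  apply: smooth_onM => //; last exact: smooth_on_cst.
  apply: (smooth_on_comp oA (B := [set x : R | 0 < x])) => //.
  - by move=> x Ax /=; rewrite divr_gt0 ?cos_atan_gt0 //; exact: f0.
  - exact: smooth_ln.
  - apply: smooth_onM => //; apply: smooth_onV => //.
      by move=> x _; exact: cos_atan_gt0.
    by apply: (smooth_on_comp oA (B := setT)) => //; have [] := smooth_cos_sin oT.
split=> /=; apply: (smooth_on_comp oA (B := setT)) => //;
  by have [] := smooth_cos_sin oT.
Qed.

Lemma smooth_on_sqrt (U : normedModType R) (A : set U) (f : U -> R) :
  open A -> (forall x, A x -> 0 < f x) ->
  smooth_on A f -> smooth_on A (fun x => Num.sqrt (f x)).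
Proof.
move=> oA f0 fS; have oP : open [set x : R | 0 < x] by exact: open_gt.
have oT : open [set: R] by exact: openT.
apply: (@smooth_on_eq _ _ _ _ (fun x => expR (ln (f x) * 2^-1))) => //.
  move=> x Ax; have fx := f0 _ Ax.
  apply/eqP; rewrite -(@eqrXn2 _ 2) ?expR_ge0 ?sqrtr_ge0 // sqr_sqrtr ?ltW //.
  by rewrite -expRM_natl mulrC -mulrA mulVf // mulr1 lnK.
apply: (smooth_on_comp oA (B := setT)) => //; first exact: smooth_expR.
apply: smooth_onM => //; last exact: smooth_on_cst.
apply: (smooth_on_comp oA (B := [set x : R | 0 < x])) => //; exact: smooth_ln.
Qed.

(* Nonzero for z and w close to a common nonzero value, which makes m-th roots
   locally unique. *)
Definition root_quot m z w : R[i] := \sum_(i < m) z ^+ (m.-1 - i) * w ^+ i.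

(** [root_quot m z w] is the cofactor of z - w in z^m - w^m. *)
Lemma root_quot_inj m z w : root_quot m z w != 0 -> z ^+ m = w ^+ m -> z = w.
Proof.
move=> q0 /eqP; rewrite -subr_eq0.
case: m q0 => [|m] q0; first by rewrite /root_quot big_ord0 eqxx in q0.
rewrite subrXX mulf_eq0 subr_eq0 => /orP[/eqP //|].
by move: q0; rewrite /root_quot /= => /negPf q0; rewrite q0.
Qed.

(** The value at the base point; for m > 0 it is nonzero, and continuity extends this to nearby
    points. *)
Lemma root_quot11 m : root_quot m 1 1 = m%:R.
Proof.
rewrite /root_quot; under eq_bigr do rewrite !expr1n mulr1.
by rewrite sumr_const card_ord.
Qed.

End ComplexValued.

(** * Charts and tangent vectors *)

Section Charts.
Variables (R : realType) (E : normedModType R) (d : nat).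
Implicit Types (M U : set E) (V : set 'rV[R]_d) (phi : 'rV[R]_d -> E)
  (psi : E -> 'rV[R]_d).

(** The chain rule applied to psi o phi = id near x. The resulting left inverse of ['d phi x] shows
    that a chart is an immersion. *)
Lemma diff_cancel V phi psi x : open V -> V x ->
  (forall y, V y -> psi (phi y) = y) ->
  differentiable phi x -> differentiable psi (phi x) ->
  forall a, 'd psi (phi x) ('d phi x a) = a.
Proof.
move=> oV Vx phiK dphi dpsi a.
have nV : \near x, (psi \o phi) x = id x.
  by apply: filterS (open_nbhs_nbhs (conj oV Vx)) => y /phiK.
have := near_eq_derive a nV.
rewrite derive_id deriveE; last exact: differentiable_comp.
by rewrite diff_comp.
Qed.

(** As [psi] is smooth on an open set of the ambient space, a curve g in M equals phi o (psi o g)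
    near 0, so its velocity lies in the image of ['d phi x]. Conversely, [phi] sends the line x + t
    a to a curve in M with velocity ['d phi x a]. *)
Lemma tangent_chart M V U phi psi x v :
  open V -> V x -> smooth_on V phi -> open U -> smooth_on U psi ->
  (forall y, V y -> [/\ M (phi y), U (phi y) & psi (phi y) = y]) ->
  (forall z, M z -> U z -> V (psi z) /\ phi (psi z) = z) ->
  tangent M (phi x) v <-> exists a, v = 'd phi x a.
Proof.
move=> oV Vx phiS oU psiS phiP psiP.
have dphi := smooth_on_differentiable phiS Vx.
have [Mx Ux psix] := phiP _ Vx.
have dpsi := smooth_on_differentiable psiS Ux.
split=> [[g [r [r0 gS gM g0 <-]]]|[a ->]].
  have B0 : ball (0 : R) r 0 by exact: ballxx.
  have dg := smooth_on_differentiable gS B0.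
  exists ('d psi (phi x) ('d g (0 : R) 1)).
  have ng : \forall t \near (0 : R), g t = phi (psi (g t)).
    have Ug : \forall t \near (0 : R), U (g t).
      apply: (differentiable_continuous dg); rewrite g0.
      exact: open_nbhs_nbhs (conj oU Ux).
    have Bt : \forall t \near (0 : R), ball (0 : R) r t.
      by apply: open_nbhs_nbhs; split => //; exact: ball_open.
    by apply: filterS2 Ug Bt => t Ut /gM Mt; have [_ ->] := psiP _ Mt Ut.
  have dpg : differentiable (psi \o g) 0.
    by apply: differentiable_comp => //; rewrite g0.
  rewrite (near_eq_derive _ ng) deriveE; last first.
    by apply: (differentiable_comp dpg); rewrite /= g0 psix.
  rewrite -[LHS]/('d (phi \o (psi \o g)) 0 1).
  rewrite (diff_comp dpg) /=; last by rewrite /= g0 psix.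
  rewrite g0 psix; congr ('d phi x _).
  by rewrite (diff_comp dg) ?g0.
have slin : linear (fun t : R => t *: a).
  by move=> k t t'; rewrite scalerDl scalerA.
pose slM := GRing.isLinear.Build _ _ _ _ _ slin.
pose sl : {linear R -> 'rV[R]_d} := HB.pack (fun t : R => t *: a) slM.
have slC : continuous sl by exact: scalel_continuous.
have oA : open [set t : R | V (x + sl t)].
  apply: (@open_comp _ _ (fun t => x + sl t)) => // t _.
  by apply: continuousD; [exact: cst_continuous|exact: slC].
have A0 : V (x + sl 0) by rewrite /= scale0r addr0.
have [r /= r0 rA] := (nbhs_ballP _ _).1 (open_nbhs_nbhs (conj oA A0)).
exists (phi \o (fun t => x + sl t)), r; split=> //.
- move=> n; apply: (class_C_sub rA); exact: class_C_affine_comp.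
- by move=> t /rA /phiP[].
- by rewrite /= scale0r addr0.
have dsl : is_diff (0 : R) (fun t => x + sl t) sl.
  exact: is_diff_affine.
have dsl' : differentiable (fun t => x + sl t) (0 : R) by exact: ex_diff.
have dphi' : differentiable phi (x + sl 0) by rewrite /= scale0r addr0.
rewrite deriveE; last exact: differentiable_comp.
by rewrite (diff_comp dsl' dphi') /= diff_val /= scale1r scale0r addr0.
Qed.

(** Reduces the construction of a chart to conditions near one point: [psi] has to invert [phi] on M
    only near [phi x], and both domains are then shrunk. *)
Lemma local_chart M V U phi psi x :
  open V -> V x -> smooth_on V phi -> open U -> U (phi x) -> smooth_on U psi ->
  (forall y, V y -> M (phi y)) ->
  (forall y, V y -> U (phi y) -> psi (phi y) = y) ->
  (\forall z \near phi x, M z -> V (psi z) /\ phi (psi z) = z) ->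
  exists V', [/\ V' `<=` V, V' x, local_param M V' phi &
    forall y, V' y -> forall v, tangent M (phi y) v <-> exists a, v = 'd phi y a].
Proof.
move=> oV Vx phiS oU Ux psiS phiM phiK psiK.
(* Taking the interior keeps the set open, and the nearness hypothesis says exactly that [phi x]
   remains in it. *)
pose U' := U `&` (fun z => M z -> V (psi z) /\ phi (psi z) = z)^°.
have oU' : open U' by apply: openI => //; exact: open_interior.
have U'x : U' (phi x) by split.
have U'K z : M z -> U' z -> V (psi z) /\ phi (psi z) = z.
  by move=> Mz [_ /interior_subset]; exact.
(* With this preimage, [psi] maps the points of M in U' into V' automatically, because phi (psi z) =
   z. *)
pose V' := V `&` phi @^-1` U'.
have V'V : V' `<=` V by exact: subIsetl.
have oV' : open V'.
  rewrite openE => y [Vy U'y]; apply: filterI.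
    exact: open_nbhs_nbhs (conj oV Vy).
  apply: (smooth_on_continuous phiS Vy).
  exact: open_nbhs_nbhs (conj oU' U'y).
have phiS' := smooth_on_sub V'V phiS.
have psiS' : smooth_on U' psi by apply: smooth_on_sub psiS; exact: subIsetl.
have phiP y : V' y -> [/\ M (phi y), U' (phi y) & psi (phi y) = y].
  by case=> Vy U'y; split; [exact: phiM|by []|apply: phiK => //; case: U'y].
have psiP z : M z -> U' z -> V' (psi z) /\ phi (psi z) = z.
  move=> Mz U'z; have [Vz zE] := U'K _ Mz U'z.
  by split=> //; split=> //; rewrite /preimage /= zE.
exists V'; split=> //; last by move=> y V'y v; exact: (tangent_chart v oV' V'y phiS' oU' psiS').
split=> //.
  move=> y V'y; have [_ U'y _] := phiP _ V'y.
  apply: (can_inj (g := 'd psi (phi y))).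
  apply: (diff_cancel oV' V'y); first by move=> z /phiP[].
    exact: smooth_on_differentiable phiS' V'y.
  exact: smooth_on_differentiable psiS' U'y.
exists U', psi; split=> //.
- apply/seteqP; split=> [_ [y /phiP[My U'y _] <-] //|z [Mz U'z]].
  by have [V'z zE] := psiP _ Mz U'z; exists (psi z).
- by move=> y /set_mem /phiP[].
- apply: continuous_subspaceW (_ : M `&` U' `<=` U') _; first exact: subIsetr.
  rewrite continuous_open_subspace //.
  by move=> z /set_mem; exact: smooth_on_continuous.
Qed.

Lemma frame_comb_diff phi x (a : 'rV[R]_d) :
  frame_comb (fun i => 'd phi x (delta_mx ord0 i)) a = 'd phi x a.
Proof.
rewrite [in RHS](row_sum_delta a) linear_sum.
by apply: eq_bigr => i _; rewrite linearZ.
Qed.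

Lemma chart_frame_basis M V phi x : local_param M V phi -> V x ->
  (forall v, tangent M (phi x) v <-> exists a, v = 'd phi x a) ->
  is_basis (tangent M (phi x)) (fun i => 'd phi x (delta_mx ord0 i)).
Proof.
move=> [_ _ inj _] Vx tanE; split=> [v|a b]; last first.
  by rewrite !frame_comb_diff; exact: inj.
rewrite tanE; split=> -[a ->]; exists a; by rewrite frame_comb_diff.
Qed.

End Charts.

(** * Lagrangian planes of C^m *)

(** The matrix determinant lemma: the bordered matrix [B] factors into block triangular matrices
    through either of its two Schur complements, and the determinants are compared. *)
Lemma det_scalar_rank1 (F : fieldType) n (a : F) (u : 'cV[F]_n) (w : 'rV[F]_n) :
  a != 0 -> \det (a%:M + u *m w) = (1 + (w *m u) 0 0 / a) * a ^+ n.
Proof.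
move=> a0; pose B := block_mx (1%:M : 'M[F]_1) (- w) u a%:M.
have B1 : B = block_mx (1%:M : 'M[F]_1) 0 u 1%:M *m block_mx 1%:M (- w) 0 (a%:M + u *m w).
  rewrite mulmx_block !mul1mx !mulmx1 !mul0mx ?mulmx0 !addr0 mulmxN.
  by congr block_mx; rewrite addrC addrK.
have B2 : B = block_mx (1%:M + a^-1 *: (w *m u)) (- w) 0 a%:M *m
    block_mx (1%:M : 'M[F]_1) 0 (a^-1 *: u) 1%:M.
  rewrite mulmx_block !mulmx1 ?mulmx0 ?mul0mx ?mulmx0 ?add0r mulNmx -scalemxAr addrK.
  by congr block_mx; rewrite mul_scalar_mx scalerA divff // scale1r.
have := congr1 (fun A => \det A) B1; rewrite B2 !det_mulmx !det_lblock !det_ublock.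
rewrite !det1 !mul1r mulr1 => <-; rewrite det_scalar; congr (_ * _).
by rewrite det_mx11 !mxE mulrC.
Qed.

Section Planes.
Variables (R : realType) (m k : nat).
Local Notation Re := (@complex.Re R).
Local Notation Im := (@complex.Im R).
Local Notation rc := (real_complex R).
Local Notation CE := (Cspace R m).
Implicit Types (u w t : 'rV[R]_m) (z v : CE) (P : 'M[R[i]]_m) (U : 'M[R]_m).

Definition cvec (x : 'I_m -> R[i]) : CE := (\row_j Re (x j), \row_j Im (x j)).

Lemma zcoord_cvec x j : zcoord (cvec x) j = x j.
Proof. by apply: complex_eqP; rewrite /= mxE. Qed.

Lemma zcoord_inj z v : (forall j, zcoord z j = zcoord v j) -> z = v.
Proof.
case: z v => z1 z2 [v1 v2] zv; congr (_, _); apply/rowP => j;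
  by have := zv j => -[].
Qed.

Definition epsmx : 'M[R]_m := diag_mx (\row_j eps R k j).

Lemma eps_sqr (j : 'I_m) : eps R k j ^+ 2 = 1.
Proof. by rewrite /eps; case: ifP => _; rewrite ?sqrrN expr1n. Qed.

Lemma epsmx_sqr : epsmx *m epsmx = 1%:M.
Proof.
rewrite mulmx_diag -diag_const_mx; congr diag_mx; apply/rowP => j.
by rewrite !mxE -expr2 eps_sqr.
Qed.

Lemma det_epsmx_neq0 : \det epsmx != 0.
Proof.
apply/eqP => d0; have := congr1 (fun A => \det A) epsmx_sqr.
by rewrite det_mulmx d0 mul0r det1 => /esym/eqP; rewrite oner_eq0.
Qed.

(** Vectors are rows, so [P] acts on the right; every tangent plane will be presented as the image
    of R^m under such a map. *)
Definition realmap P u : CE := cvec (fun j => (map_mx rc u *m P) 0 j).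

Lemma zcoord_realmap P u j : zcoord (realmap P u) j = (map_mx rc u *m P) 0 j.
Proof. by rewrite zcoord_cvec. Qed.

Lemma zcoord_frame_comb (e : 'I_m -> CE) (a : 'rV[R]_m) j :
  zcoord (frame_comb e a) j = \sum_i rc (a 0 i) * zcoord (e i) j.
Proof.
apply: complex_eqP.
  rewrite Re_sum /frame_comb /= (big_morph (fun v : CE => v.1) (id1 := 0) (op1 := +%R)) // summxE.
  by apply: eq_bigr => i _; rewrite mul0r subr0 /= mxE.
rewrite Im_sum /frame_comb /= (big_morph (fun v : CE => v.2) (id1 := 0) (op1 := +%R)) // summxE.
by apply: eq_bigr => i _; rewrite mul0r addr0 /= mxE.
Qed.

Lemma frame_comb_realmap P U a :
  frame_comb (fun i => realmap P (row i U)) a = realmap P (a *m U).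
Proof.
apply: zcoord_inj => j; rewrite zcoord_frame_comb zcoord_realmap.
rewrite map_mxM -mulmxA mxE; apply: eq_bigr => i _.
by rewrite zcoord_realmap map_row -row_mul !mxE.
Qed.

Lemma dz_realmap P U : dz (fun i => realmap P (row i U)) = rc (\det U) * \det P.
Proof.
rewrite -det_map_mx -det_mulmx /dz; congr (\det _); apply/matrixP => i j.
by rewrite mxE zcoord_realmap map_row -row_mul mxE.
Qed.

Definition pseudo_unitary P : Prop :=
  P *m map_mx rc epsmx *m map_mx conjc P^T = map_mx rc epsmx.

(** The real part of this Hermitian form is [gmetric] and its imaginary part is the opposite of
    [omega]. Its being real on the image of R^m thus yields both the induced metric and the
    vanishing of [omega]. *)
Lemma herm_realmap P u w : pseudo_unitary P ->
  \sum_j rc (eps R k j) * (zcoord (realmap P u) j * conjc (zcoord (realmap P w) j)) =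
  rc ((u *m epsmx *m w^T) 0 0).
Proof.
move=> PP; pose ru := map_mx rc u; pose rw := map_mx rc w.
have -> : rc ((u *m epsmx *m w^T) 0 0) =
    (ru *m P *m map_mx rc epsmx *m map_mx conjc (rw *m P)^T) 0 0.
  have -> : map_mx conjc (rw *m P)^T = map_mx conjc P^T *m rw^T.
    rewrite trmx_mul map_mxM; congr (_ *m _).
    by apply/matrixP => i j; rewrite !mxE; exact: conjc_real.
  rewrite -!mulmxA (mulmxA P) (mulmxA (P *m _)) PP.
  by rewrite map_trmx -!map_mxM [RHS]mxE mulmxA.
rewrite map_diag_mx [RHS]mxE; apply: eq_bigr => j _.
rewrite mul_mx_diag !zcoord_realmap -/ru -/rw [in RHS]mxE [X in _ = _ * X]mxE.
rewrite [X in _ = _ * conjc X]mxE [X in _ = _ * X * _]mxE [X in _ = _ * _ X * _]mxE.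
by rewrite mulrA [in RHS](mulrC ((ru *m P) 0 j)).
Qed.

Lemma gmetric_realmap P u w : pseudo_unitary P ->
  gmetric k (realmap P u) (realmap P w) = (u *m epsmx *m w^T) 0 0.
Proof.
move=> PP; rewrite -[RHS]/(Re (rc _)) -(herm_realmap _ _ PP) Re_sum.
apply: eq_bigr => j _; rewrite ReM ReM /= mul0r subr0; congr (_ * _).
by case: (realmap P u) (realmap P w) => a b [c d] /=; ring.
Qed.

Lemma omega_realmap P u w : pseudo_unitary P ->
  omega k (realmap P u) (realmap P w) = 0.
Proof.
move=> PP; have /(congr1 Im) := herm_realmap u w PP.
rewrite Im_sum [RHS]/= => h; apply: oppr_inj; rewrite oppr0 -h -sumrN.
apply: eq_bigr => j _; rewrite ImM ImM /= mul0r addr0 -mulrN; congr (_ * _).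
by case: (realmap P u) (realmap P w) => a b [c d] /=; ring.
Qed.

(** * Tangent planes that are images of R^m *)

Section TangentPlane.
Variables (M : set CE) (p : CE) (P : 'M[R[i]]_m).
Hypotheses (PP : pseudo_unitary P) (dP : \det P = 1).
Hypothesis tanE : forall v, tangent M p v <-> exists u, v = realmap P u.

Lemma realmap0 : realmap P 0 = 0.
Proof.
apply: zcoord_inj => j; rewrite zcoord_realmap map_mx0 mul0mx mxE.
by apply: complex_eqP; rewrite /= mxE.
Qed.

Lemma tangent_omega z v : tangent M p z -> tangent M p v -> omega k z v = 0.
Proof. by move=> /tanE[a ->] /tanE[b ->]; exact: omega_realmap. Qed.

Lemma realmap_nondeg u :
  (forall w, gmetric k (realmap P u) (realmap P w) = 0) -> u = 0.
Proof.
move=> u0; suff uD : u *m epsmx = 0.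
  by rewrite -[u]mulmx1 -epsmx_sqr mulmxA uD mul0mx.
apply/rowP => j; have := u0 (delta_mx 0 j); rewrite gmetric_realmap //.
by rewrite trmx_delta -colE !mxE.
Qed.

Lemma tangent_nondeg z : tangent M p z ->
  (forall v, tangent M p v -> gmetric k z v = 0) -> z = 0.
Proof.
move=> /tanE[a ->] a0; rewrite (@realmap_nondeg a) ?realmap0 // => w.
by apply: a0; apply/tanE; exists w.
Qed.

Lemma tangent_frame (e : 'I_m -> CE) : (forall i, tangent M p (e i)) ->
  exists U, e = fun i => realmap P (row i U).
Proof.
move=> eT; have /(@choice _ _) [f fE] : forall i, exists u, e i = realmap P u.
  by move=> i; exact/tanE.
exists (\matrix_i f i); apply/funext => i; rewrite fE; congr realmap.
by rewrite rowK.
Qed.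

Lemma basis_frame (e : 'I_m -> CE) : is_basis (tangent M p) e ->
  exists U, e = fun i => realmap P (row i U).
Proof.
move=> [eT _]; apply: tangent_frame => i; apply/eT.
exists (delta_mx 0 i); rewrite /frame_comb (bigD1 i) //= mxE !eqxx scale1r.
by rewrite big1 ?addr0 // => l /negPf li; rewrite mxE li andbF scale0r.
Qed.

Lemma realmap_basis : is_basis (tangent M p) (fun i => realmap P (row i 1%:M)).
Proof.
split=> [v|a b]; first by rewrite tanE; split=> -[a ->]; exists a;
  rewrite frame_comb_realmap mulmx1.
rewrite !frame_comb_realmap !mulmx1 => ab; apply/subr0_eq/realmap_nondeg => w.
rewrite gmetric_realmap // mulmxBl mulmxBl [LHS]mxE [X in _ + X]mxE.
by rewrite -!(gmetric_realmap _ _ PP) ab subrr.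
Qed.

Lemma lorentz_dz (e : 'I_m -> CE) : lorentz_basis k M p e -> 0 < Re (dz e) -> dz e = 1.
Proof.
move=> [/basis_frame[U ->] eg]; rewrite dz_realmap dP mulr1 /= => U0.
suff U2 : \det U ^+ 2 = 1.
  move: U2 => /eqP; rewrite sqrf_eq1 => /orP[/eqP -> //|/eqP U1].
  by move: U0; rewrite U1 oppr_gt0 ltr10.
(* The Gram matrix of a Lorentz basis; its determinant forces det U to be 1 or -1, and positivity
   then decides. *)
have UD : U *m epsmx *m U^T = epsmx.
  apply/matrixP => i j; have := eg i j; rewrite gmetric_realmap // => h.
  transitivity ((row i U *m epsmx *m (row j U)^T) 0 0); last first.
    by rewrite h !mxE mulrb.
  by rewrite -row_mul [LHS]mxE [RHS]mxE; apply: eq_bigr => l _; rewrite !mxE.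
have := congr1 (fun A => \det A) UD; rewrite !det_mulmx det_tr => h.
by apply: (mulIf det_epsmx_neq0); rewrite mul1r -[RHS]h; ring.
Qed.

(** The reference frame is the image of the standard basis of R^m. Since det P = 1, the transition
    matrix from it to [e] has determinant [dz e]. *)
Lemma positive_basis :
  exists e0, is_basis (tangent M p) e0 /\ forall e,
    (is_basis (tangent M p) e /\ 0 < Re (dz e)) <->
    (is_basis (tangent M p) e /\ same_orientation e0 e).
Proof.
exists (fun i => realmap P (row i 1%:M)); split; first exact: realmap_basis.
move=> e; split=> -[eb]; have [U eU] := basis_frame eb.
  rewrite eU dz_realmap dP mulr1 /= => U0; split; first by rewrite -eU.
  by exists U; split=> // i; rewrite frame_comb_realmap mulmx1.
move=> [A [A0 eA]]; split=> //.
have -> : e = (fun i => realmap P (row i A)).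
  by apply/funext => i; rewrite eA frame_comb_realmap mulmx1.
by rewrite dz_realmap dP mulr1.
Qed.

End TangentPlane.

(** Separates the linear algebra from the geometry of M. The matrix [U] expresses the coordinate
    frame of the chart, and its positive determinant makes the orientation by Re dz > 0
    continuous. *)
Lemma special_lagrangian_charts (M : set CE) :
  (forall p, M p -> exists V phi, [/\ local_param M V phi, (phi @` V) p &
     forall x, V x ->
       (forall v, tangent M (phi x) v <-> exists a, v = 'd phi x a) /\
       exists P U, [/\ pseudo_unitary P, \det P = 1, 0 < \det U &
         forall i, 'd phi x (delta_mx ord0 i) = realmap P (row i U)]]) ->
  exists O, special_lagrangian k M O.
Proof.
move=> MC.
have MT p : M p -> exists P, [/\ pseudo_unitary P, \det P = 1 &
    forall v, tangent M p v <-> exists u, v = realmap P u].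
  move=> Mp; have [V [phi [Vphi [x Vx <-] /(_ _ Vx)[tE [P [U [PP dP dU fE]]]]]]] := MC _ Mp.
  exists P; split=> // v; rewrite tE.
  have dphi a : 'd phi x a = realmap P (a *m U).
    by rewrite -frame_comb_diff -frame_comb_realmap; congr frame_comb; apply/funext.
  split=> [[a ->]|[u ->]]; first by exists (a *m U); rewrite dphi.
  (* Invertibility of [U] makes the image of the differential the whole plane. *)
  by exists (u *m invmx U); rewrite dphi mulmxKV // unitmxE unitfE lt0r_neq0.
exists (fun p e => is_basis (tangent M p) e /\ 0 < Re (dz e)); split.
- split=> [p Mp|p Mp|p Mp].
  + by have [V [phi [Vphi pV _]]] := MC _ Mp; exists V, phi.
  + by have [P [PP _ tE]] := MT _ Mp; exact: tangent_omega PP tE.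
  + by have [P [PP _ tE]] := MT _ Mp; exact: tangent_nondeg PP tE.
- move=> p Mp; split.
    by have [P [PP dP tE]] := MT _ Mp; exact: positive_basis PP dP tE.
  have [V [phi [Vphi pV C]]] := MC _ Mp; exists V, phi; split=> // x Vx.
  have [tE [P [U [PP dP dU fE]]]] := C _ Vx; split.
    exact: chart_frame_basis Vphi Vx tE.
  have -> : (fun i => 'd phi x (delta_mx ord0 i)) = fun i => realmap P (row i U).
    exact/funext.
  by rewrite dz_realmap dP mulr1.
- move=> p Mp e eL [_ e0]; have [P [PP dP tE]] := MT _ Mp.
  exact: lorentz_dz PP dP tE _ eL e0.
Qed.

(* In a basis adapted to the eps-orthogonal splitting R^m = t^perp + R t, the
   matrix coneplane s a b t is diag (a, ..., a, b). *)
Definition coneplane (s : R) (a b : R[i]) t : 'M[R[i]]_m :=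
  a%:M + ((b - a) * rc s) *: map_mx rc (epsmx *m t^T *m t).

Section ConePlane.
Variables (s : R) (a b : R[i]) (t : 'rV[R]_m).
Hypotheses (s2 : s ^+ 2 = 1) (ts : (t *m epsmx *m t^T) 0 0 = s).

(** A scalar plus a rank-one matrix; because s^2 = 1, the scalar product of the two rank-one factors
    is b - a. *)
Lemma det_coneplane : (0 < m)%N -> a != 0 ->
  \det (coneplane s a b t) = a ^+ m.-1 * b.
Proof.
move=> m0 a0; rewrite /coneplane map_mxM scalemxAl det_scalar_rank1 //.
have -> : (map_mx rc t *m (((b - a) * rc s) *: map_mx rc (epsmx *m t^T))) 0 0 = b - a.
  rewrite -scalemxAr -map_mxM mulmxA mxE [X in _ * X]mxE ts.
  by rewrite -mulrA -[rc s * _]rmorphM -expr2 s2 rmorph1 mulr1.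
by case: m m0 => // n _ /=; rewrite exprS; field.
Qed.

Lemma coneplane_pseudo_unitary : a * conjc a = 1 -> b * conjc b = 1 ->
  pseudo_unitary (coneplane s a b t).
Proof.
move=> aa bb; rewrite /pseudo_unitary /coneplane.
set g := (b - a) * rc s; set D := map_mx rc epsmx.
set T := map_mx rc t.
have DT : D^T = D by rewrite /D map_trmx tr_diag_mx.
have cD : map_mx conjc D = D by apply/matrixP => i j; rewrite !mxE; exact: conjc_real.
have cT : map_mx conjc T = T by apply/matrixP => i j; rewrite !mxE; exact: conjc_real.
have cTT : map_mx conjc T^T = T^T by rewrite -map_trmx cT.
have TDT : T *m D *m T^T = (rc s)%:M.
  rewrite map_trmx -!map_mxM; apply/matrixP => i j; rewrite !ord1.
  by rewrite mxE ts mxE eqxx mulr1n.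
have -> : map_mx rc (epsmx *m t^T *m t) = D *m T^T *m T.
  by rewrite !map_mxM map_trmx.
clearbody D T.
have -> : map_mx conjc (a%:M + g *: (D *m T^T *m T))^T =
    (conjc a)%:M + conjc g *: (T^T *m T *m D).
  rewrite linearD linearZ /= tr_scalar_mx !trmx_mul trmxK DT mulmxA.
  by rewrite map_mxD map_mxZ map_scalar_mx !map_mxM cTT cT cD.
pose N := D *m T^T *m T *m D.
have NE : D *m T^T *m T *m D *m (T^T *m T *m D) = rc s *: N.
  rewrite -[LHS](_ : D *m T^T *m (T *m D *m T^T) *m T *m D = _); last by rewrite !mulmxA.
  by rewrite TDT mul_mx_scalar /N -!scalemxAl.
rewrite mulmxDl mulmxDr !mulmxDl mul_scalar_mx !mul_mx_scalar -!scalemxAl -!scalemxAr.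
rewrite NE -/N !mulmxA -/N !scalerA mulrC aa scale1r.
have gE : conjc g = (conjc b - conjc a) * rc s.
  by rewrite /g rmorphM rmorphB; congr (_ * _); exact: conjc_real.
have s2' : rc s * rc s = 1 by rewrite -rmorphM -expr2 s2 rmorph1.
(* Apart from the term in [D], everything is a multiple of [N], with coefficient s (|b|^2 - |a|^2) =
   0. *)
rewrite -addrA -!scalerDl -[RHS]addr0; congr (_ + _).
rewrite -[RHS](scale0r N); congr (_ *: _); rewrite gE /g.
transitivity (rc s * (conjc a * b + a * conjc b - a * conjc a *+ 2 +
    (b - a) * (conjc b - conjc a) * (rc s * rc s))); first by ring.
rewrite s2'; transitivity (rc s * (b * conjc b - a * conjc a)); first by ring.
by rewrite aa bb subrr mulr0.
Qed.

End ConePlane.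
End Planes.

(** * Coordinates *)

(** Expansion along column j0 leaves one term, whose minor is the scalar matrix r; the other entries
    of row j0 do not enter. *)
Lemma det_col_scalar (F : comNzRingType) n (B : 'M[F]_n) (j0 : 'I_n) (r : F) :
  (forall i, i != j0 -> B i j0 = 0) ->
  (forall i j, i != j0 -> j != j0 -> B i j = r *+ (i == j)) ->
  \det B = B j0 j0 * r ^+ n.-1.
Proof.
case: n B j0 => [|n] B j0 B0 Br; first by have [] := j0.
rewrite (expand_det_col B j0) (bigD1 j0) //= big1 ?addr0 => [|i ij]; last first.
  by rewrite B0 // mul0r.
rewrite /cofactor -signr_odd oddD addbb expr0 mul1r; congr (_ * _).
rewrite (_ : row' _ _ = r%:M) ?det_scalar //.
apply/matrixP => i j; rewrite !mxE Br; last 2 first.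
- by rewrite eq_sym neq_lift.
- by rewrite eq_sym neq_lift.
by rewrite (inj_eq (@lift_inj _ j0)).
Qed.

Section SmoothSets.
Variables (R : realType) (E : normedModType R).
Implicit Types (A : set E) (f : E -> R) (p : E).

Lemma open_smooth_gt0 A f : open A -> smooth_on A f ->
  open (A `&` [set x | 0 < f x]).
Proof.
move=> oA fS; rewrite openE => x [Ax fx]; apply: filterI.
  exact: open_nbhs_nbhs (conj oA Ax).
have f0 : nbhs (f x) [set y | 0 < y].
  by apply: open_nbhs_nbhs; split => //; exact: open_gt.
exact: (smooth_on_continuous fS Ax f0).
Qed.

Lemma near_smooth_gt0 A f p : open A -> A p -> smooth_on A f -> 0 < f p ->
  \forall x \near p, A x /\ 0 < f x.
Proof.
move=> oA Ap fS fp.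
exact: (open_nbhs_nbhs (conj (open_smooth_gt0 oA fS) (conj Ap fp))).
Qed.

End SmoothSets.

Lemma smooth_on_scalel (R : realType) (U W : normedModType R) (A : set U) (f : U -> R) (w : W) :
  open A -> smooth_on A f -> smooth_on A (fun x => f x *: w).
Proof.
move=> oA fS; have lin : linear (fun t : R => t *: w).
  by move=> b y z; rewrite scalerDl scalerA.
pose lM := GRing.isLinear.Build _ _ _ _ _ lin.
pose l : {linear R -> W} := HB.pack (fun t : R => t *: w) lM.
by move=> r; apply: (@class_C_linear_comp _ _ _ _ _ _ l) => //; exact: scalel_continuous.
Qed.

Section Coordinates.
Variables (R : realType) (m : nat).
Local Notation Re := (@complex.Re R).
Local Notation Im := (@complex.Im R).
Local Notation CE := (Cspace R m).

Lemma smooth_coord (A : set 'rV[R]_m) j : smooth_on A (fun x => x 0 j).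
Proof.
have lin : linear (fun x : 'rV[R]_m => x 0 j : R).
  by move=> a x y; rewrite !mxE.
pose lM := GRing.isLinear.Build _ _ _ _ _ lin.
pose l : {linear 'rV[R]_m -> R} := HB.pack (fun x : 'rV[R]_m => x 0 j) lM.
apply: (@smooth_on_linear _ _ _ _ l); exact: coord_continuous.
Qed.

Lemma derive_coord (x a : 'rV[R]_m) j : 'D_a (fun y : 'rV[R]_m => y 0 j) x = a 0 j.
Proof.
have lin : linear (fun x : 'rV[R]_m => x 0 j : R).
  by move=> b y z; rewrite !mxE.
pose lM := GRing.isLinear.Build _ _ _ _ _ lin.
pose l : {linear 'rV[R]_m -> R} := HB.pack (fun x : 'rV[R]_m => x 0 j) lM.
have lC : continuous l by exact: coord_continuous.
have ld : differentiable l x by exact: linear_differentiable.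
by have := deriveE a ld; rewrite diff_lin.
Qed.

Definition re_coord (j : 'I_m) (z : CE) : R := z.1 0 j.
Definition im_coord (j : 'I_m) (z : CE) : R := z.2 0 j.

Fact re_coord_linear j : linear (re_coord j).
Proof. by move=> a [x1 x2] [y1 y2]; rewrite /re_coord /= !mxE. Qed.

Fact im_coord_linear j : linear (im_coord j).
Proof. by move=> a [x1 x2] [y1 y2]; rewrite /im_coord /= !mxE. Qed.

HB.instance Definition _ j :=
  GRing.isLinear.Build R CE R _ (re_coord j) (re_coord_linear j).
HB.instance Definition _ j :=
  GRing.isLinear.Build R CE R _ (im_coord j) (im_coord_linear j).

Lemma re_coord_continuous j : continuous (re_coord j).
Proof.
by move=> z; apply: (@continuous_comp _ _ _ fst (fun x : 'rV[R]_m => x 0 j));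
  [exact: cvg_fst|exact: coord_continuous].
Qed.

Lemma im_coord_continuous j : continuous (im_coord j).
Proof.
by move=> z; apply: (@continuous_comp _ _ _ snd (fun x : 'rV[R]_m => x 0 j));
  [exact: cvg_snd|exact: coord_continuous].
Qed.

Lemma csmooth_zcoord (A : set CE) j : csmooth A (fun z => zcoord z j).
Proof.
by split; [apply: (@smooth_on_linear _ _ _ _ (re_coord j)); exact: re_coord_continuous
          |apply: (@smooth_on_linear _ _ _ _ (im_coord j)); exact: im_coord_continuous].
Qed.

Lemma zcoord_derive (U : normedModType R) (f : U -> CE) (x a : U) j :
  differentiable f x ->
  zcoord ('D_a f x) j = cderive a (fun y => zcoord (f y) j) x.
Proof.
move=> fd; apply: complex_eqP => /=.
  exact/esym/(derive_linear_comp a (@re_coord_continuous j) fd).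
exact/esym/(derive_linear_comp a (@im_coord_continuous j) fd).
Qed.

Lemma smooth_on_row (U : normedModType R) (A : set U) (f : U -> 'rV[R]_m) :
  open A -> (forall j, smooth_on A (fun x => f x 0 j)) -> smooth_on A f.
Proof.
move=> oA fS.
rewrite (_ : f = fun x => \sum_j f x 0 j *: delta_mx 0 j).
  by apply: smooth_on_sum => // j _; exact: smooth_on_scalel.
by apply/funext => x; exact: row_sum_delta.
Qed.

Lemma smooth_on_cvec (U : normedModType R) (A : set U) (f : U -> 'I_m -> R[i]) :
  open A -> (forall j, csmooth A (fun x => f x j)) -> smooth_on A (fun x => cvec (f x)).
Proof.
move=> oA fS.
rewrite (_ : (fun _ => _) = fun x => \sum_j (Re (f x j) *: ((delta_mx 0 j, 0) : CE) +
    Im (f x j) *: ((0, delta_mx 0 j) : CE))).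
  apply: smooth_on_sum => // j _; have [f1 f2] := fS j.
  by apply: smooth_onD => //; exact: smooth_on_scalel.
apply/funext => x; rewrite big_split /=; apply: zcoord_inj => j.
rewrite zcoord_cvec; apply: complex_eqP => /=.
  rewrite (big_morph (fun v : CE => v.1) (id1 := 0) (op1 := +%R)) //.
  rewrite (big_morph (fun v : CE => v.1) (id1 := 0) (op1 := +%R)) //=.
  rewrite mxE !summxE (bigD1 j) //= !mxE !eqxx mulr1 big1 ?addr0.
    by rewrite big1 ?addr0 // => i _; rewrite !mxE mulr0.
  by move=> i /negPf ij; rewrite !mxE eqxx /= [j == i]eq_sym ij mulr0.
rewrite (big_morph (fun v : CE => v.2) (id1 := 0) (op1 := +%R)) //.
rewrite (big_morph (fun v : CE => v.2) (id1 := 0) (op1 := +%R)) //=.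
rewrite mxE !summxE [X in X + _]big1 ?add0r; last by move=> i _; rewrite !mxE mulr0.
rewrite (bigD1 j) //= !mxE !eqxx mulr1 big1 ?addr0 //.
by move=> i /negPf ij; rewrite !mxE eqxx /= [j == i]eq_sym ij mulr0.
Qed.

End Coordinates.

Section ConePlaneVector.
Variables (R : realType) (m k : nat).
Local Notation rc := (real_complex R).

Lemma epsform (u w : 'rV[R]_m) :
  (u *m epsmx R m k *m w^T) 0 0 = \sum_j eps R k j * (u 0 j * w 0 j).
Proof.
rewrite mxE; apply: eq_bigr => j _.
by rewrite mul_mx_diag !mxE; ring.
Qed.

(** The part orthogonal to [t] is scaled by [a], the multiple of [t] by [b]. *)
Lemma zcoord_coneplane (s : R) (a b : R[i]) (t tau : 'rV[R]_m) (rho : R) j :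
  s ^+ 2 = 1 -> (t *m epsmx R m k *m t^T) 0 0 = s ->
  (tau *m epsmx R m k *m t^T) 0 0 = 0 ->
  zcoord (realmap (coneplane k s a b t) (tau + rho *: t)) j =
  a * rc (tau 0 j) + b * rc rho * rc (t 0 j).
Proof.
move=> s2 ts tau0; rewrite zcoord_realmap /coneplane mulmxDr mul_mx_scalar.
rewrite -scalemxAr -map_mxM !mulmxA.
have -> : (tau + rho *: t) *m epsmx R m k *m t^T = (rho * s)%:M.
  apply/matrixP => i l; rewrite !ord1 !mulmxDl -!scalemxAl mxE tau0 add0r.
  by rewrite mxE ts [RHS]mxE eqxx mulr1n.
rewrite mul_scalar_mx !mxE !rmorphD !rmorphM.
have s2' : rc s * rc s = 1 by rewrite -rmorphM -expr2 s2 rmorph1.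
transitivity (a * (rc (tau 0 j) + rc rho * rc (t 0 j)) +
  (b - a) * (rc s * rc s) * rc rho * rc (t 0 j)); first by ring.
by rewrite s2'; ring.
Qed.

End ConePlaneVector.

(** * The chart of M_c *)

Section Cone.
Variables (R : realType) (m k : nat) (s c : R).
Local Notation Re := (@complex.Re R).
Local Notation Im := (@complex.Im R).
Local Notation rc := (real_complex R).
Local Notation CE := (Cspace R m).
Local Notation epsR := (eps R k).
Hypotheses (s2 : s ^+ 2 = 1) (m0 : (0 < m)%N).
Local Notation M := (@Mc R m k s c).

Definition cquad (z : CE) : R[i] := \sum_j rc (epsR j) * zcoord z j ^+ 2.

Lemma cquad_cone (z : CE) (t : 'rV[R]_m) (l : R[i]) :
  \sum_(j < m) epsR j * t ord0 j ^+ 2 = s ->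
  (forall j, zcoord z j = l * rc (t ord0 j)) -> cquad z = rc s * l ^+ 2.
Proof.
move=> ts zE; rewrite -ts rmorph_sum /= mulr_suml; apply: eq_bigr => j _.
by rewrite zE rmorphM rmorphXn exprMn mulrCA mulrC.
Qed.

Variables (l0 : R[i]) (t0 : 'rV[R]_m) (p : CE) (j0 : 'I_m).
Hypotheses (l00 : l0 != 0) (t0s : \sum_(j < m) epsR j * t0 ord0 j ^+ 2 = s)
  (l0c : Im (l0 ^+ m) = c) (pE : forall j, zcoord p j = l0 * rc (t0 ord0 j))
  (t00 : t0 ord0 j0 != 0).

Let sg : R := Num.sg (t0 ord0 j0).
(* This choice of sign makes the chart positively oriented. *)
Let dl : R := s * sg * epsR j0.

(** The value of t_j0^2 forced by q(t) = s. *)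
Definition height (x : 'rV[R]_m) : R :=
  epsR j0 * (s - \sum_(j < m | j != j0) epsR j * x ord0 j ^+ 2).
Definition tcoord (x : 'rV[R]_m) (j : 'I_m) : R :=
  if j == j0 then sg * Num.sqrt (height x) else x ord0 j.
Definition lpow (x : 'rV[R]_m) : R[i] := Complex (dl * x ord0 j0) c.
(** The branch through [l0] of the m-th root of [lpow x]: division by [l0 ^+ m] moves the base value
    to 1. *)
Definition lchart (x : 'rV[R]_m) : R[i] := l0 * croot m (lpow x / l0 ^+ m).
Definition chart (x : 'rV[R]_m) : CE := cvec (fun j => lchart x * rc (tcoord x j)).
Definition chart_dom : set 'rV[R]_m :=
  [set x | 0 < height x] `&` [set x | 0 < Re (lpow x / l0 ^+ m)].

(** The quotient l / l0, recovered from its square. The principal root picks the sign for which it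
    is near 1 at points near p. *)
Definition kinv (z : CE) : R[i] := croot 2 (rc s * cquad z / l0 ^+ 2).
Definition linv (z : CE) : R[i] := l0 * kinv z.
(** On M_c near p these ratios are real; taking real parts extends the formula to an open set of
    C^m. *)
Definition chart_inv (z : CE) : 'rV[R]_m :=
  \row_j if j == j0 then dl * Re (linv z ^+ m) else Re (zcoord z j / linv z).
Definition inv_dom : set CE :=
  [set: CE] `&` [set z | 0 < Re (rc s * cquad z / l0 ^+ 2)].

Lemma sg_sqr : sg ^+ 2 = 1.
Proof. by rewrite /sg sqr_sg t00. Qed.

Lemma dl_sqr : dl ^+ 2 = 1.
Proof. by rewrite /dl !exprMn s2 sg_sqr eps_sqr !mulr1. Qed.

Lemma smooth_height (A : set 'rV[R]_m) : open A -> smooth_on A height.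
Proof.
move=> oA; apply: smooth_onM => //; first exact: smooth_on_cst.
apply: smooth_onB => //; first exact: smooth_on_cst.
apply: smooth_on_sum => // j _; apply: smooth_onM => //; first exact: smooth_on_cst.
by apply: smooth_onX => //; exact: smooth_coord.
Qed.

Lemma csmooth_lpow (A : set 'rV[R]_m) : open A -> csmooth A lpow.
Proof.
move=> oA; split=> /=; last exact: smooth_on_cst.
by apply: smooth_onM => //; [exact: smooth_on_cst|exact: smooth_coord].
Qed.

Lemma csmooth_lpowV (A : set 'rV[R]_m) : open A -> csmooth A (fun x => lpow x / l0 ^+ m).
Proof. by move=> oA; apply: csmoothM => //; [exact: csmooth_lpow|exact: csmooth_cst]. Qed.

Lemma open_chart_dom : open chart_dom.
Proof.
have oT : open [set: 'rV[R]_m] by exact: openT.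
have o1 := open_smooth_gt0 oT (smooth_height oT).
have [h _] := csmooth_lpowV oT.
have o2 := open_smooth_gt0 oT h.
by have := openI o1 o2; rewrite !setTI.
Qed.

Lemma smooth_tcoord j : smooth_on chart_dom (fun x => tcoord x j).
Proof.
have oV := open_chart_dom; rewrite /tcoord; case: eqP => _; last exact: smooth_coord.
apply: smooth_onM => //; first exact: smooth_on_cst.
by apply: smooth_on_sqrt => //; [move=> x []|exact: smooth_height].
Qed.

Lemma csmooth_lchart : csmooth chart_dom lchart.
Proof.
have oV := open_chart_dom; apply: csmoothM => //; first exact: csmooth_cst.
by apply: csmooth_croot => //; [move=> x []|exact: csmooth_lpowV].
Qed.

Lemma smooth_chart : smooth_on chart_dom chart.
Proof.
have oV := open_chart_dom; apply: smooth_on_cvec => // j.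
apply: csmoothM => //; first exact: csmooth_lchart.
by apply: csmooth_real; exact: smooth_tcoord.
Qed.

Lemma csmooth_kinv_arg (A : set CE) : open A ->
  csmooth A (fun z => rc s * cquad z / l0 ^+ 2).
Proof.
move=> oA; apply: csmoothM => //; last exact: csmooth_cst.
apply: csmoothM => //; first exact: csmooth_cst.
apply: csmooth_sum => // j _; apply: csmoothM => //; first exact: csmooth_cst.
by apply: csmoothX => //; exact: csmooth_zcoord.
Qed.

Lemma open_inv_dom : open inv_dom.
Proof.
have oT : open [set: CE] by exact: openT.
by apply: open_smooth_gt0 => //; have [] := csmooth_kinv_arg oT.
Qed.

Lemma csmooth_kinv : csmooth inv_dom kinv.
Proof.
have oU := open_inv_dom; apply: csmooth_croot => //; first by move=> z [].
exact: csmooth_kinv_arg.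
Qed.

Lemma csmooth_linv : csmooth inv_dom linv.
Proof.
have oU := open_inv_dom.
by apply: csmoothM => //; [exact: csmooth_cst|exact: csmooth_kinv].
Qed.

Lemma linv_neq0 z : linv z != 0.
Proof. by rewrite mulf_neq0 // Re_gt0_neq0 // Re_croot_gt0. Qed.

Lemma lchart_neq0 x : lchart x != 0.
Proof. by rewrite mulf_neq0 // Re_gt0_neq0 // Re_croot_gt0. Qed.

Lemma csmooth_ratio j : csmooth inv_dom (fun z => zcoord z j / linv z).
Proof.
have oU := open_inv_dom; apply: csmoothM => //; first exact: csmooth_zcoord.
by apply: csmoothV => //; [move=> z _; exact: linv_neq0|exact: csmooth_linv].
Qed.

Lemma smooth_chart_inv : smooth_on inv_dom chart_inv.
Proof.
have oU := open_inv_dom; apply: smooth_on_row => // j.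
under eq_fun do rewrite mxE; case: eqP => _; last by have [] := csmooth_ratio j.
apply: smooth_onM => //; first exact: smooth_on_cst.
by have [] := csmoothX oU m csmooth_linv.
Qed.

Lemma lchartX x : chart_dom x -> lchart x ^+ m = lpow x.
Proof.
by move=> [_ x0]; rewrite exprMn crootX // mulrC divfK // expf_neq0.
Qed.

Lemma linvX z : inv_dom z -> linv z ^+ 2 = rc s * cquad z.
Proof.
by move=> [_ z0]; rewrite exprMn crootX // mulrC divfK // expf_neq0.
Qed.

Lemma tcoord_cone x : chart_dom x -> \sum_(j < m) epsR j * tcoord x j ^+ 2 = s.
Proof.
move=> [x0 _]; rewrite (bigD1 j0) //= {1}/tcoord eqxx exprMn sg_sqr mul1r.
rewrite sqr_sqrtr ?ltW // /height mulrA -expr2 eps_sqr mul1r.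
rewrite -addrA -[RHS]addr0; congr (_ + _); rewrite addrC.
apply/eqP; rewrite subr_eq0; apply/eqP/eq_bigr => j /negPf jj.
by rewrite /tcoord jj.
Qed.

Lemma chart_cone x : chart_dom x -> M (chart x).
Proof.
move=> Vx; exists (\row_j tcoord x j), (lchart x); split.
- by under eq_bigr do rewrite mxE; exact: tcoord_cone.
- exact: lchart_neq0.
- by rewrite lchartX.
- by move=> j; rewrite zcoord_cvec mxE.
Qed.

(** * The chart and its inverse near the base point *)

Lemma rcs_sqr : rc s * rc s = 1.
Proof. by rewrite -rmorphM -expr2 s2 rmorph1. Qed.

Lemma chartK x : chart_dom x -> inv_dom (chart x) -> chart_inv (chart x) = x.
Proof.
move=> Vx Ux.
have lE : linv (chart x) = lchart x.
  (* Both quotients by [l0] lie in the right half-plane and have the same square, so they agree. *)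
  rewrite /linv /lchart; congr (_ * _); apply: eq_sqr_Re_gt0; try exact: Re_croot_gt0.
  apply: (mulfI (expf_neq0 2 l00)); rewrite -!exprMn.
  rewrite -/(linv _) -/(lchart _) linvX //.
  rewrite (@cquad_cone _ (\row_j tcoord x j) (lchart x)).
  - by rewrite mulrA rcs_sqr mul1r.
  - by under eq_bigr do rewrite mxE; exact: tcoord_cone.
  - by move=> j; rewrite zcoord_cvec mxE.
apply/rowP => j; rewrite mxE lE; case: eqP => [->|/eqP/negPf jj].
  by rewrite lchartX //= mulrA -expr2 dl_sqr mul1r.
by rewrite zcoord_cvec mulrC mulKf ?lchart_neq0 // /tcoord jj.
Qed.

Lemma base_inv_dom : inv_dom p.
Proof.
split=> //=; rewrite (cquad_cone t0s pE) mulrA rcs_sqr mul1r divff ?ltr01 //.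
exact: expf_neq0.
Qed.

Lemma base_kinv : kinv p = 1.
Proof.
rewrite /kinv (cquad_cone t0s pE) mulrA rcs_sqr mul1r divff ?croot1 //.
exact: expf_neq0.
Qed.

Lemma base_linv : linv p = l0.
Proof. by rewrite /linv base_kinv mulr1. Qed.

(* The last condition excludes the parameters (- l, - t) when m is odd. *)
Lemma near_base : \forall z \near p,
  [/\ inv_dom z, 0 < Re (kinv z ^+ m), root_quot m (kinv z) (croot m (kinv z ^+ m)) != 0,
      0 < sg * Re (zcoord z j0 / linv z) & c != 0 -> 0 < c * Im (linv z ^+ m)].
Proof.
have oU := open_inv_dom; have Up := base_inv_dom.
have kmS := csmoothX oU m csmooth_kinv.
have [kmS1 _] := kmS.
have km0 : 0 < Re (kinv p ^+ m) by rewrite base_kinv expr1n /= ltr01.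
have n1 := near_smooth_gt0 oU Up kmS1 km0.
(* The m-th root inside [root_quot] is smooth where its argument has positive real part, so the
   domain is cut down before continuity is used. *)
pose A := inv_dom `&` [set z | 0 < Re (kinv z ^+ m)].
have oA : open A by exact: open_smooth_gt0.
have [kS1 kS2] := csmooth_kinv.
have sub : A `<=` inv_dom by exact: subIsetl.
have kSA : csmooth A kinv by split; [exact: smooth_on_sub kS1|exact: smooth_on_sub kS2].
have [FS _] : csmooth A (fun z => root_quot m (kinv z) (croot m (kinv z ^+ m))).
  apply: csmooth_sum => // i _; apply: csmoothM => //; first exact: csmoothX.
  apply: csmoothX => //; apply: csmooth_croot => //; first by move=> z [].
  exact: csmoothX.
have n2 : \forall z \near p, A z /\ 0 < Re (root_quot m (kinv z) (croot m (kinv z ^+ m))).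
  apply: near_smooth_gt0 => //.
  by rewrite base_kinv expr1n croot1 root_quot11 -(rmorph_nat rc) /= ltr0n.
have [rS _] := csmooth_ratio j0.
have n3 : \forall z \near p, inv_dom z /\ 0 < sg * Re (zcoord z j0 / linv z).
  apply: near_smooth_gt0 => //; first by apply: smooth_onM => //; exact: smooth_on_cst.
  by rewrite base_linv pE [_ / l0]mulrC mulKf //= /sg -normrEsg normr_gt0.
have [_ lS] := csmoothX oU m csmooth_linv.
have n4 : \forall z \near p, c != 0 -> 0 < c * Im (linv z ^+ m).
  have [->|c0] := eqVneq c 0; first by apply: filterE.
  have : \forall z \near p, inv_dom z /\ 0 < c * Im (linv z ^+ m).
    apply: near_smooth_gt0 => //; first by apply: smooth_onM => //; exact: smooth_on_cst.
    by rewrite base_linv l0c -expr2 lt_def sqr_ge0 sqrf_eq0 c0.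
  by apply: filterS => z [].
near=> z.
have [Uz z1] : inv_dom z /\ 0 < Re (kinv z ^+ m) by near: z.
have [_ z2] : A z /\ 0 < Re (root_quot m (kinv z) (croot m (kinv z ^+ m))) by near: z.
have [_ z3] : inv_dom z /\ 0 < sg * Re (zcoord z j0 / linv z) by near: z.
split=> //; first exact: Re_gt0_neq0.
by near: z.
Unshelve. all: by end_near. Qed.

(** A representation (l, t) of z has l equal to [linv z] or its opposite. In the second case t is
    replaced by -t; for odd m this would give Im (linv z)^m = -c, which the sign condition excludes
    unless c = 0. *)
Lemma cone_linv z : inv_dom z -> (c != 0 -> 0 < c * Im (linv z ^+ m)) -> M z ->
  exists t : 'rV[R]_m, [/\ \sum_(j < m) epsR j * t ord0 j ^+ 2 = s,
    Im (linv z ^+ m) = c & forall j, zcoord z j = linv z * rc (t ord0 j)].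
Proof.
move=> Uz zc [t [l [ts l00' lc zE]]].
have : linv z ^+ 2 = l ^+ 2.
  by rewrite linvX // (cquad_cone ts zE) mulrA rcs_sqr mul1r.
move=> /eqP; rewrite eqf_sqr => /orP[/eqP lE|/eqP lE]; first by exists t; rewrite lE.
exists (- t); split.
- by rewrite -[RHS]ts; apply: eq_bigr => j _; rewrite mxE sqrrN.
- move: lc zc; rewrite lE exprNn -signr_odd; case: (odd m) => /=; last first.
    by rewrite expr0 mul1r.
  rewrite expr1 mulN1r; case: (l ^+ m) => x y /= ->.
  have [->|c0 /(_ isT)] := eqVneq c 0; first by rewrite oppr0.
  by rewrite mulrN oppr_gt0 -expr2 ltNge sqr_ge0.
- by move=> j; rewrite zE lE mxE rmorphN mulrNN.
Qed.

Lemma near_chart_inv : \forall z \near p,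
  M z -> chart_dom (chart_inv z) /\ chart (chart_inv z) = z.
Proof.
near=> z => Mz.
have [Uz z1 z2 z3 z4] : [/\ inv_dom z, 0 < Re (kinv z ^+ m),
    root_quot m (kinv z) (croot m (kinv z ^+ m)) != 0,
    0 < sg * Re (zcoord z j0 / linv z) & c != 0 -> 0 < c * Im (linv z ^+ m)].
  by near: z; exact: near_base.
have [t [ts tc zE]] := cone_linv Uz z4 Mz.
set x := chart_inv z.
have xj j : j != j0 -> x ord0 j = t ord0 j.
  by move=> /negPf jj; rewrite mxE jj zE mulrC mulKf ?linv_neq0.
have xE : lpow x = linv z ^+ m.
  apply: complex_eqP => /=; last by rewrite tc.
  by rewrite mxE eqxx mulrA -expr2 dl_sqr mul1r.
have kE : lpow x / l0 ^+ m = kinv z ^+ m.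
  by rewrite xE exprMn mulrC mulKf // expf_neq0.
have t1 : 0 < sg * t ord0 j0.
  by move: z3; rewrite zE [_ / linv z]mulrC mulKf ?linv_neq0.
have hE : height x = t ord0 j0 ^+ 2.
  rewrite /height -ts (bigD1 j0) //= [X in _ - X](eq_bigr (fun j => epsR j * t ord0 j ^+ 2)).
    by rewrite addrK mulrA -expr2 eps_sqr mul1r.
  by move=> j jj; rewrite xj.
have tn0 : t ord0 j0 != 0 by apply: contraTneq t1 => ->; rewrite mulr0 ltxx.
(* Two m-th roots of the same number are compared. For m >= 3 both can lie in the right half-plane
   without being equal, hence the appeal to [root_quot]. *)
have lE : lchart x = linv z.
  rewrite /lchart /linv kE; congr (_ * _); apply/esym.
  by apply: (root_quot_inj z2); rewrite crootX.
have tE j : tcoord x j = t ord0 j.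
  rewrite /tcoord; case: eqP => [->|/eqP/xj //].
  (* Near p the coordinate t_j0 keeps the sign [sg], so [sg] times its absolute value is t_j0
     itself. *)
  rewrite hE sqrtr_sqr -[X in `|X|]mul1r -sg_sqr expr2 -mulrA normrM.
  rewrite (gtr0_norm t1) normr_sg t00 mul1r mulrA -expr2 sg_sqr mul1r //.
split; last by apply: zcoord_inj => j; rewrite zcoord_cvec lE tE zE.
split; rewrite /= ?kE // hE lt_def sqr_ge0 sqrf_eq0 tn0 //.
Unshelve. all: by end_near. Qed.

(** * The tangent frame of the chart *)

Local Notation trow x := (\row_j tcoord x j).

Definition tderive (x a : 'rV[R]_m) : 'rV[R]_m :=
  \row_j 'D_a (fun y => tcoord y j) x.

Lemma trow_form x : chart_dom x -> (trow x *m epsmx R m k *m (trow x)^T) 0 0 = s.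
Proof.
move=> Vx; rewrite epsform -[RHS](tcoord_cone Vx).
by apply: eq_bigr => j _; rewrite !mxE expr2.
Qed.

(** Differentiate q(t) = s, constant along the chart. *)
Lemma tderive_orth x a : chart_dom x ->
  (tderive x a *m epsmx R m k *m (trow x)^T) 0 0 = 0.
Proof.
move=> Vx; have oV := open_chart_dom.
have TS j := smooth_tcoord j.
have T2S j : smooth_on chart_dom (fun y => tcoord y j * tcoord y j).
  exact: smooth_onM.
have nE : \forall y \near x, \sum_(j < m) epsR j * (tcoord y j * tcoord y j) = s.
  apply: filterS (open_nbhs_nbhs (conj oV Vx)) => y Vy.
  rewrite -[RHS](tcoord_cone Vy).
  by apply: eq_bigr => j _; rewrite expr2.
have := near_eq_derive a nE; rewrite (derive_cst s) (derive_smooth_sum _ Vx); last first.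
  by move=> j; apply: smooth_onM => //; exact: smooth_on_cst.
under eq_bigr do rewrite (derive_smoothMl _ Vx) // (derive_smoothM _ Vx) //.
move=> h; have n2 : 2 != 0 :> R by rewrite pnatr_eq0.
apply: (mulfI n2); rewrite mulr0 -[RHS]h epsform mulr_sumr.
by apply: eq_bigr => j _; rewrite !mxE; ring.
Qed.

Lemma tderive_delta x i j : j != j0 -> tderive x (delta_mx 0 i) 0 j = (i == j)%:R.
Proof.
move=> /negPf jj; rewrite mxE /tcoord jj derive_coord mxE eqxx /=.
by rewrite eq_sym.
Qed.

(** Differentiate [lchart ^+ m = lpow]: the imaginary part of the right side is the constant c, so m
    l^(m-1) dl is real. *)
Lemma cderive_lchart x a : chart_dom x ->
  cderive a lchart x = (lchart x ^+ m.-1)^-1 * rc (dl * a ord0 j0 / m%:R).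
Proof.
move=> Vx; have oV := open_chart_dom.
have nE : \forall y \near x, lchart y ^+ m = lpow y.
  by apply: filterS (open_nbhs_nbhs (conj oV Vx)) => y; exact: lchartX.
have := near_eq_cderive a nE; rewrite (cderiveX oV _ _ Vx csmooth_lchart).
have -> : cderive a lpow x = rc (dl * a ord0 j0).
  apply: complex_eqP => /=; last by rewrite (derive_cst c).
  by rewrite (derive_smoothMl _ Vx) ?derive_coord //; exact: smooth_coord.
have m1 : rc m%:R != 0.
  by rewrite -(rmorph0 rc) (inj_eq (@complexI R)) pnatr_eq0 -lt0n.
rewrite -(rmorph_nat rc) => h.
have l1 : lchart x ^+ m.-1 != 0 by rewrite expf_neq0 // lchart_neq0.
have -> : rc (dl * a ord0 j0 / m%:R) = rc (dl * a ord0 j0) / rc m%:R.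
  exact: fmorph_div.
rewrite -h; field.
by rewrite ?l1 ?m1 ?pnatr_eq0 -?lt0n ?m0.
Qed.

Lemma diff_chart x a j : chart_dom x ->
  zcoord ('d chart x a) j = lchart x * rc (tderive x a ord0 j) +
    (lchart x ^+ m.-1)^-1 * rc (dl * a ord0 j0 / m%:R) * rc (tcoord x j).
Proof.
move=> Vx; have dchart := smooth_on_differentiable smooth_chart Vx.
rewrite -deriveE // zcoord_derive //.
under [X in cderive _ X]eq_fun do rewrite zcoord_cvec.
have TS := csmooth_real (smooth_tcoord j).
rewrite (cderiveM open_chart_dom _ Vx csmooth_lchart TS) cderive_lchart // addrC.
congr (_ + _); congr (_ * _); rewrite mxE.
by apply: complex_eqP; rewrite /= ?derive_cst.
Qed.

(** With r = |l|, put a = l / r and b = a^(1-m), both of modulus one and with a^(m-1) b = 1. The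
    real factors r and r^(1-m) go into [U], whose i-th row splits into [tau i], orthogonal to t, and
    a multiple of t. *)
Lemma chart_frame x : chart_dom x -> exists P U,
  [/\ pseudo_unitary k P, \det P = 1, 0 < \det U &
    forall i, 'd chart x (delta_mx ord0 i) = realmap P (row i U)].
Proof.
move=> Vx; set l := lchart x; set t := trow x.
have l1 : l != 0 by exact: lchart_neq0.
pose r := Num.sqrt (Re l ^+ 2 + Im l ^+ 2).
have r2 : r ^+ 2 = Re l ^+ 2 + Im l ^+ 2 by rewrite sqr_sqrtr // ltW // sqr_Re_Im_gt0.
have r0 : 0 < r by rewrite sqrtr_gt0 sqr_Re_Im_gt0.
have r1 : r != 0 by exact: lt0r_neq0.
have rc0 (y : R) : y != 0 -> rc y != 0 by rewrite -(inj_eq (@complexI R)).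
have ll : l * conjc l = rc r ^+ 2.
  rewrite -rmorphXn /= r2; case: (l) => u w /=.
  by apply: complex_eqP; rewrite ?ReM ?ImM /=; ring.
have crc (y : R) : conjc (rc y) = rc y by exact: conjc_real.
have cl1 : conjc l != 0 by rewrite conjc_eq0.
pose a := l / rc r; pose b := (l ^+ m.-1)^-1 * rc r ^+ m.-1.
have aa : a * conjc a = 1.
  have -> : conjc a = conjc l / rc r.
    by rewrite /a rmorphM fmorphV; congr (_ / _); exact: crc.
  rewrite mulrACA ll -invfM -expr2 divff //.
  by rewrite expf_neq0 // rc0.
have bE : b = a^-1 ^+ m.-1 by rewrite exprVn /a exprMn exprVn invfM invrK.
have a0 : a != 0 by rewrite mulf_neq0 // invr_eq0 rc0.
have bb : b * conjc b = 1.
  by rewrite bE rmorphXn fmorphV -exprMn -invfM aa invr1 expr1n.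
have ts : (t *m epsmx R m k *m t^T) 0 0 = s by exact: trow_form.
pose rho (i : 'I_m) : R := dl *+ (i == j0) / m%:R * (r ^+ m.-1)^-1.
pose tau i := r *: tderive x (delta_mx ord0 i).
have tau0 i : (tau i *m epsmx R m k *m t^T) 0 0 = 0.
  by rewrite -!scalemxAl mxE tderive_orth // mulr0.
pose U := \matrix_i (tau i + rho i *: t).
exists (coneplane k s a b t), U; split.
- exact: coneplane_pseudo_unitary.
- by rewrite det_coneplane // bE -exprMn divff // expr1n.
(* Right multiplication by [C] replaces column j0 of [U] by the q-products of its rows with t. These
   are [rho i * s], zero unless i = j0, so det (U C) falls under [det_col_scalar]. *)
- pose C := \matrix_(i < m, j < m) if j == j0 then epsR i * t ord0 i else (i == j)%:R.
  have UE i j : U i j = tau i ord0 j + rho i * t ord0 j.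
    by rewrite /U mxE [LHS]mxE [X in _ + X]mxE.
  have detC : \det C = epsR j0 * t ord0 j0.
    rewrite -det_tr (@det_col_scalar _ _ _ j0 1).
    + by rewrite expr1n mulr1 !mxE eqxx.
    + by move=> i /negPf ij; rewrite !mxE ij eq_sym ij.
    + by move=> i j /negPf ij _; rewrite !mxE ij eq_sym.
  have UC0 i : (U *m C) i j0 = rho i * s.
    have := tau0 i; rewrite epsform => ti; have := ts; rewrite epsform => ts'.
    have -> : rho i * s = \sum_j (epsR j * (tau i ord0 j * t ord0 j) +
        rho i * (epsR j * (t ord0 j * t ord0 j))).
      by rewrite big_split /= ti add0r -mulr_sumr ts'.
    rewrite mxE; apply: eq_bigr => j _.
    by rewrite UE [C _ _]mxE eqxx /=; ring.
  have UCj i j : j != j0 -> (U *m C) i j = U i j.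
    move=> /negPf jj; rewrite mxE (bigD1 j) //= big1 ?addr0.
      by rewrite [C _ _]mxE jj eqxx mulr1.
    by move=> q /negPf qj; rewrite [C _ _]mxE jj qj mulr0.
  have detUC : \det (U *m C) = dl * s / m%:R.
    rewrite (@det_col_scalar _ _ _ j0 r).
    + rewrite UC0 /rho eqxx mulr1n; field.
      by rewrite pnatr_eq0 -lt0n m0 expf_neq0.
    + by move=> i /negPf ij; rewrite UC0 /rho ij mulr0n !mul0r.
    + move=> i j /negPf ij jj; rewrite UCj // UE /rho ij mulr0n !mul0r addr0.
      by rewrite /tau mxE tderive_delta // mulr_natr.
  have := detUC; rewrite det_mulmx detC /t mxE /tcoord eqxx => dE.
  have hx : 0 < Num.sqrt (height x) by rewrite sqrtr_gt0; case: Vx.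
  (* Here the sign in [dl] pays off: dl s = eps_j0 sg because s^2 = 1, and this cancels the sign of
     det C. *)
  have {}dE : \det U * Num.sqrt (height x) = m%:R^-1.
    have e0 : epsR j0 * sg != 0.
      by rewrite mulf_neq0 // -sqrf_eq0 ?eps_sqr ?sg_sqr oner_eq0.
    apply: (mulIf e0); transitivity (\det U * (epsR j0 * (sg * Num.sqrt (height x)))).
      by ring.
    rewrite dE /dl; transitivity (s ^+ 2 * (m%:R^-1 * (epsR j0 * sg))); first by ring.
    by rewrite s2 mul1r.
  by rewrite -(pmulr_lgt0 _ hx) dE invr_gt0 ltr0n.
- move=> i; apply: zcoord_inj => j; rewrite diff_chart // -/l rowK.
  rewrite zcoord_coneplane // [t ord0 j]mxE; congr (_ + _ * _).
    rewrite /tau [X in _ = _ * rc X]mxE /a [rc (r * _)]rmorphM mulrA divfK //.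
    exact: rc0.
  rewrite /b -[RHS]mulrA; congr (_ * _).
  transitivity (rc (r ^+ m.-1 * rho i)); last by rewrite rmorphM rmorphXn.
  congr (rc _).
  rewrite /rho mxE eqxx /= mulr_natr [j0 == i]eq_sym; field.
  by rewrite pnatr_eq0 -lt0n m0 expf_neq0.
Qed.

Lemma cone_local_chart : exists V phi, [/\ local_param M V phi, (phi @` V) p &
  forall x, V x ->
    (forall v, tangent M (phi x) v <-> exists a, v = 'd phi x a) /\
    exists P U, [/\ pseudo_unitary k P, \det P = 1, 0 < \det U &
      forall i, 'd phi x (delta_mx ord0 i) = realmap P (row i U)]].
Proof.
have Mp : M p by exists t0, l0; split.
have [Vx px] := nbhs_singleton near_chart_inv Mp.
have Up := base_inv_dom; have nI := near_chart_inv.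
have [V [VV Vp Vloc VT]] : exists V', [/\ V' `<=` chart_dom, V' (chart_inv p),
    local_param M V' chart & forall y, V' y -> forall v,
      tangent M (chart y) v <-> exists a, v = 'd chart y a].
  apply: (local_chart open_chart_dom Vx smooth_chart open_inv_dom _ smooth_chart_inv
    chart_cone chartK); first by rewrite px.
  by rewrite px.
exists V, chart; split=> //; first by exists (chart_inv p).
by move=> x Vx'; split; [exact: VT|exact/chart_frame/VV].
Qed.

End Cone.

Lemma special_lagrangian_Mc (R : realType) (m k : nat) (s c : R) :
  (0 < m)%N -> s ^+ 2 = 1 -> exists O, special_lagrangian k (@Mc R m k s c) O.
Proof.
move=> m0 s2; apply: special_lagrangian_charts => p [t [l [ts l0 lc pE]]].
(* Since q(t) = s is nonzero, t cannot vanish. *)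
have [j tj] : exists j, t ord0 j != 0.
  apply/existsP; rewrite -[X in is_true X]negbK negb_exists; apply/negP => /forallP t0.
  move: s2; rewrite -ts big1 ?expr0n => [/eqP|j _]; first by rewrite eq_sym oner_eq0.
  by have := t0 j; rewrite negbK => /eqP ->; rewrite expr0n mulr0.
exact: (cone_local_chart s2 m0 l0 ts lc pE tj).
Qed.

Theorem theorem4p5 (R : realType) (m k : nat) (c : R)
    (hm : (1 <= m)%N) (hk : (k <= m)%N) :
  (exists O, special_lagrangian k (@Mc R m k 1 c) O) /\
  (exists O, special_lagrangian k (@Mc R m k (-1) c) O).
Proof.
by split; apply: special_lagrangian_Mc => //; rewrite ?sqrrN expr1n.
Qed.
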